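(* Let $\mathcal L:\sum_{i=1}^k c_i x_i=0$ be a homogeneous linear equation with $k\ge 3$ and $c_1,\dots,c_k\in\mathbb Z\setminus\{0\}$. Then $\delta_\chi(\mathcal L)=0$ if and only if there exists a subset $I\subseteq[k]$ with $|I|\ge 3$ and $\sum_{i\in I}c_i=0$.
   Context: For a prime $p$, $\mathbb F_p$ is the field with $p$ elements. A set $A\subseteq\mathbb F_p$ is $\mathcal L$-solution-free if there is no solution $(x_1,\dots,x_k)\in A^k$ of $\sum_i c_ix_i=0$ (in $\mathbb F_p$) with $x_1,\dots,x_k$ pairwise distinct. For an abelian group $\Gamma$ and $A\subseteq\Gamma$, $\mathsf{Cay}(\Gamma,A)$ is the Cayley digraph on vertex set $\Gamma$ with an arc $u\to v$ whenever $v-u\in A$; its chromatic number $\chi$ means the chromatic number of the underlying undirected graph. The chromatic threshold is $\delta_\chi(\mathcal L)=\inf\{d>0:\ \exists C=C(\mathcal L,d)$ such that for every prime $p$ and every $\mathcal L$-solution-free $A\subseteq\mathbb F_p$ with $|A|\ge dp$, $\chi(\mathsf{Cay}(\mathbb F_p,A))\le C\}$. Equivalently, $\delta_\chi(\mathcal L)=0$ means every $\mathcal L$-solution-free $A\subseteq\mathbb F_p$ whose Cayley graph has chromatic number tending to infinity as $p\to\infty$ has size $o(p)$. *)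

(* Defs.v *)
From HB Require Import structures.
From mathcomp Require Import all_boot all_order all_algebra.
From mathcomp Require Import classical_sets reals.
Set Implicit Arguments. Unset Strict Implicit. Unset Printing Implicit Defensive.
Import Order.TTheory GRing.Theory Num.Theory.
Local Open Scope ring_scope.
Local Open Scope classical_set_scope.

Definition solution_free (k : nat) (c : 'I_k -> int) (p : nat) (A : {set 'F_p}) : Prop :=
  ~ exists x : 'I_k -> 'F_p,
      [/\ injective x, (forall i, x i \in A) & \sum_(i < k) (c i)%:~R * x i = 0].

(* chi(Cay(F_p, A)) <= C : a proper C-colouring of the underlying undirected
   graph, where u and v (u <> v) are adjacent iff v - u \in A or u - v \in A. *)
Definition cayley_colorable (p : nat) (A : {set 'F_p}) (C : nat) : Prop :=
  exists f : 'F_p -> 'I_C,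
    forall u v : 'F_p, u != v -> v - u \in A -> f u != f v.

Definition good_densities (R : realType) (k : nat) (c : 'I_k -> int) : set R :=
  [set d : R | 0 < d /\
     exists C : nat, forall p : nat, prime p -> forall A : {set 'F_p},
       solution_free c A -> d * p%:R <= (#|A|)%:R -> cayley_colorable A C].

Definition delta_chi (R : realType) (k : nat) (c : 'I_k -> int) : R :=
  inf (@good_densities R k c).

(* Main.v *)
(* Write [p] for the prime and [N] for the size of the ambient field.

   Suppose [c] sums to zero on a set [I] of at least three indices, and let [A] have density [d].
   The number [h t] of solutions of [sum_(i in I) c_i z_i = t] in [A] is almost periodic by
   Croot-Sisask sampling, and an energy increment on the smoothings of [A] along sets of almost
   periods gives Roth's theorem in Varnavides' form: [h 0 >= delta N ^ (#|I| - 1)].  Let [X] be the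
   set of [x] in [A] such that every [c_l x] is an almost period of [h].  If [X] has [k] elements,
   put them at the indices outside [I]: [h] is still large at the required value, most of the
   solutions counted there have distinct entries, and [A] is not solution-free.  If [X] has fewer
   than [k] elements, then [Cay(F_p, X)] is a union of few cycles, while [Cay(F_p, A \ X)] is
   coloured by boundedly many translates of a dense set of almost periods.

   Suppose [c] has no such [I]; then [sigma = sum c_l] is non-zero, and we take a prime [q] not
   dividing it.  Think of [x] in [F_p] as a point of an [n]-dimensional torus through the fractional
   parts of [K ^ j x / p].  Let [A2] consist of points close to [1 / q] in all but few coordinates.
   By a Borsuk-Ulam type theorem for [Z/q], its Cayley graph has large chromatic number.  Let [A1]
   consist of points [x] such that the word in [(Z/q) ^ n] recording the coordinates of [a x] lies in
   a dense set containing no two words that differ by [sigma] in almost all coordinates, and such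
   that one extra coordinate of [a x] is close to a fixed small [theta], whereas that coordinate is
   close to 0 on [A2].  In a solution with entries in [A1] and [A2], the extra coordinate forces the
   coefficients of the entries in [A1] to sum to zero, so there are none or two of them; the other
   coordinates rule out both cases, with [a] the common absolute value of two opposite coefficients.
*)
Require Import Defs.
From HB Require Import structures.
From mathcomp Require Import all_boot all_order all_algebra.
From mathcomp Require Import reals.
From mathcomp Require Import zify ring lra.
Set Implicit Arguments. Unset Strict Implicit. Unset Printing Implicit Defensive.
Import Order.TTheory GRing.Theory Num.Theory.
Local Open Scope ring_scope.

(** * Ordered cochains on words *)

Section Cochains.
Variable V : eqType.
Implicit Types (Phi Psi : seq V -> int) (s r : seq V).

(* Lists of length [i + 1] are the ordered [i]-simplices, and [[::]] carries the augmentation. *)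
Fixpoint cobd Phi s : int :=
  if s is x :: s' then Phi s' - cobd (fun r => Phi (x :: r)) s' else 0.

(** The prism operator in dual form: on [x_0, ..., x_m] it is the alternating sum of the values of
    [Phi] at [f x_0, ..., f x_i, g x_i, ..., g x_m]. *)
Fixpoint prism (f g : V -> V) Phi s : int :=
  if s is x :: s' then
    Phi (f x :: g x :: map g s') - prism f g (fun r => Phi (f x :: r)) s'
  else 0.

Lemma eq_cobd_in Phi Psi s :
  (forall r, size r = (size s).-1 -> {subset r <= s} -> Phi r = Psi r) ->
  cobd Phi s = cobd Psi s.
Proof.
elim: s Phi Psi => [//|x s IHs] Phi Psi eqPP /=.
rewrite eqPP //; last by move=> y ys; rewrite inE ys orbT.
congr (_ - _); case: s IHs eqPP => [//|z s] IHs eqPP.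
apply: IHs => r sz_r sub_r; apply: eqPP => /=; first by rewrite sz_r.
by move=> y; rewrite inE => /predU1P[->|/sub_r ys]; rewrite in_cons ?eqxx ?ys ?orbT.
Qed.

Lemma eq_cobd Phi Psi : Phi =1 Psi -> cobd Phi =1 cobd Psi.
Proof. by move=> eqPP s; apply: eq_cobd_in => r _ _. Qed.

Lemma cobdD Phi Psi s : cobd (fun r => Phi r + Psi r) s = cobd Phi s + cobd Psi s.
Proof. by elim: s Phi Psi => [|x s IHs] Phi Psi /=; rewrite ?IHs; ring. Qed.

Lemma cobdB Phi Psi s : cobd (fun r => Phi r - Psi r) s = cobd Phi s - cobd Psi s.
Proof. by elim: s Phi Psi => [|x s IHs] Phi Psi /=; rewrite ?IHs; ring. Qed.

Lemma cobdZ (a : int) Phi s : cobd (fun r => a * Phi r) s = a * cobd Phi s.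
Proof. by elim: s Phi => [|x s IHs] Phi /=; rewrite ?IHs; ring. Qed.

Lemma cobd0 s : cobd (fun=> 0) s = 0.
Proof. by elim: s => //= x s ->. Qed.

Lemma cobd_sum (I : finType) (P : I -> seq V -> int) s :
  cobd (fun r => \sum_i P i r) s = \sum_i cobd (P i) s.
Proof.
elim: s P => [|x s IHs] P /=; first by rewrite big1.
by rewrite IHs -sumrB.
Qed.

Lemma cobd_map (f : V -> V) Phi s : cobd (fun r => Phi (map f r)) s = cobd Phi (map f s).
Proof. by elim: s Phi => [//|x s IHs] Phi /=; rewrite -IHs. Qed.

Lemma cobdK Phi s : cobd (cobd Phi) s = 0.
Proof. by elim: s Phi => [//|x s IHs] Phi /=; rewrite cobdB IHs subr0 subrr. Qed.

Lemma prismB f g Phi Psi s :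
  prism f g (fun r => Phi r - Psi r) s = prism f g Phi s - prism f g Psi s.
Proof. by elim: s Phi Psi => [|x s IHs] Phi Psi /=; rewrite ?IHs; ring. Qed.

Lemma prism_homotopy f g Phi s :
  cobd (prism f g Phi) s + prism f g (cobd Phi) s = Phi (map g s) - Phi (map f s).
Proof.
elim: s Phi => [|x s IHs] Phi; first by rewrite [RHS]subrr.
rewrite /= cobdB prismB -(cobd_map g (fun r => Phi (f x :: g x :: r))).
have := IHs (fun r => Phi (f x :: r)).
set u1 := cobd (prism f g (fun r => Phi (f x :: r))) s => e.
have -> : u1 = Phi (f x :: map g s) - Phi (f x :: map f s)
     - prism f g (cobd (fun r => Phi (f x :: r))) s by rewrite -e addrK.
ring.
Qed.

Lemma prism_eq0 f g Phi s :
  (forall r, size r = (size s).+1 -> {subset r <= map f s ++ map g s} -> Phi r = 0) ->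
  prism f g Phi s = 0.
Proof.
elim: s Phi => [//|x s IHs] Phi Phi0 /=.
rewrite Phi0 /=; last 2 first.
- by rewrite size_map.
- by move=> y; rewrite !inE mem_cat !inE => /or3P[->|->|->]; rewrite ?orbT.
rewrite IHs ?subrr // => r sz_r sub_r; apply: Phi0; first by rewrite /= sz_r.
move=> y; rewrite inE => /predU1P[->|/sub_r]; rewrite /= !(inE, mem_cat) ?eqxx //.
by case/orP=> ->; rewrite ?orbT.
Qed.

End Cochains.

Lemma val_Zp_succ (Q : nat) (u : 'I_Q.+2) : nat_of_ord (u + 1)%R = (if u == (-1)%R then 0%N else u.+1).
Proof.
rewrite -(subr_eq0 u) opprK; case: ifP => [/eqP-> //| u1].
have: (u + 1 : 'I_Q.+2) <> 0 by apply/eqP; rewrite u1.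
move/eqP; rewrite -val_eqE /= (modn_small (_ : 1 < Q.+2)%N) // addn1 => h.
apply: modn_small; rewrite ltn_neqAle ltn_ord andbT.
by apply: contraNneq h => ->; rewrite modnn.
Qed.

Lemma val_Zp_opp1 (Q : nat) : nat_of_ord (-1 : 'I_Q.+2)%R = Q.+1.
Proof. by rewrite /= (modn_small (_ : 1 < Q.+2)%N) // subn1 modn_small. Qed.

Section Words.
Variables (n Q : nat).
Local Notation Z := 'I_Q.+2.
Local Notation V := {ffun 'I_n -> Z}.
Implicit Types (x y z : V) (s r : seq V) (Phi Psi : seq V -> int).

Definition hdist x y : nat := #|[set i | x i != y i]|.

Definition shift (a : Z) x : V := [ffun i => x i + a].

Lemma hdistC x y : hdist x y = hdist y x.
Proof. by apply: eq_card => i; rewrite !inE eq_sym. Qed.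

Lemma hdistxx x : hdist x x = 0%N.
Proof. by apply: eq_card0 => i; rewrite !inE eqxx. Qed.

Lemma hdist_triangle x y z : (hdist x z <= hdist x y + hdist y z)%N.
Proof.
apply: leq_trans (leq_card_setU _ _); apply/subset_leq_card/subsetP => i.
by rewrite !inE; case: (eqVneq (x i) (y i)) => [->|].
Qed.

Lemma hdist_shift a x y : hdist (shift a x) (shift a y) = hdist x y.
Proof. by apply: eq_card => i; rewrite !inE !ffunE (inj_eq (addIr a)). Qed.

Lemma shift0 x : shift 0 x = x.
Proof. by apply/ffunP => i; rewrite ffunE addr0. Qed.

Lemma shiftD a b x : shift a (shift b x) = shift (b + a) x.
Proof. by apply/ffunP => i; rewrite !ffunE addrA. Qed.

(** These lists are the ordered simplices of the Vietoris-Rips complex of the Hamming metric at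
    scale [d]. *)
Definition small d s := forall x y, x \in s -> y \in s -> (hdist x y <= d)%N.

Lemma small_shift d a s : small d s -> small d (map (shift a) s).
Proof. by move=> sm _ _ /mapP[x xs ->] /mapP[y ys ->]; rewrite hdist_shift; apply: sm. Qed.

Definition zeroed (j : nat) x : V := [ffun i : 'I_n => if (i < j)%N then 0 else x i].

Lemma hdist_zeroed j x y u v :
  u \in [:: zeroed j x; zeroed j.+1 x] -> v \in [:: zeroed j y; zeroed j.+1 y] ->
  (hdist u v <= (hdist x y).+1)%N.
Proof.
move=> ux vy; case: (ltnP j n) => [jn | nj].
  suff sub : [set i | u i != v i] \subset Ordinal jn |: [set i | x i != y i].
    apply: leq_trans (subset_leq_card sub) _; rewrite cardsU1.
    exact: leq_add (leq_b1 _) (leqnn _).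
  apply/subsetP => i; rewrite !inE (_ : (i == Ordinal jn) = (i == j :> nat)) //.
  by move: ux vy; rewrite !inE => /orP[]/eqP-> /orP[]/eqP->; rewrite !ffunE ?ltnS;
    case: (ltngtP (i : nat) j); rewrite ?eqxx.
apply: leqW; apply/subset_leq_card/subsetP => i; rewrite !inE.
have ij : (i < j)%N by apply: leq_trans nj.
by move: ux vy; rewrite !inE => /orP[]/eqP-> /orP[]/eqP->; rewrite !ffunE ?ltnS ?ij ?(ltnW ij) ?eqxx.
Qed.

(* Zeroing the coordinates one at a time contracts every word to 0; each step moves words by
   Hamming distance at most 1, so filling a cocycle costs one unit of diameter. *)
Lemma acyclic Phi d m :
  (forall s, small d.+1 s -> size s = m.+2 -> cobd Phi s = 0) ->
  exists Psi, forall s, small d s -> size s = m.+1 -> cobd Psi s = Phi s.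
Proof.
move=> closed.
pose o : V := [ffun=> 0].
pose P j := prism (zeroed j) (zeroed j.+1) Phi.
(* The prisms deform the identity to the constant map at [o]; the cone from [o] in the first term
   fills what remains there. *)
exists (fun s => Phi (o :: map (fun=> o) s) - \sum_(j < n) P j s) => s sm sz.
have zeroed0 : map (zeroed 0) s = s.
  by rewrite -[RHS]map_id; apply: eq_map => x; apply/ffunP => i; rewrite ffunE.
have zeroedn : map (zeroed n) s = map (fun=> o) s.
  by apply: eq_map => x; apply/ffunP => i; rewrite !ffunE ltn_ord.
rewrite cobdB cobd_sum (cobd_map (fun=> o) (fun r => Phi (o :: r))).
have := closed (o :: map (fun=> o) s); rewrite /= => closed_o.
have -> : cobd (fun r => Phi (o :: r)) (map (fun=> o) s) = Phi (map (fun=> o) s).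
  apply/eqP; rewrite eq_sym -subr_eq0 closed_o //= ?size_map ?sz //.
  have all_o u : u \in o :: map (fun=> o) s -> u = o.
    by rewrite inE => /predU1P[->|/mapP[? _ ->]].
  by move=> x y /all_o-> /all_o->; rewrite hdistxx.
have -> : \sum_(j < n) cobd (P j) s = \sum_(j < n) (Phi (map (zeroed j.+1) s) - Phi (map (zeroed j) s)).
  apply: eq_bigr => j _; rewrite -prism_homotopy.
  rewrite (prism_eq0 (s := s)) ?addr0 // => r; rewrite sz => szr sub_r; apply: closed => //.
  have in_r u : u \in r -> exists2 x, x \in s & u \in [:: zeroed j x; zeroed j.+1 x].
    by move/sub_r; rewrite mem_cat => /orP[]/mapP[x xs ->]; exists x; rewrite // !inE eqxx ?orbT.
  move=> u v /in_r[x xs ux] /in_r[y ys vy]; apply: leq_trans (hdist_zeroed ux vy) _.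
  by rewrite ltnS sm.
rewrite -(big_mkord xpredT (fun j => Phi (map (zeroed j.+1) s) - Phi (map (zeroed j) s))).
rewrite telescope_sumr // zeroed0 zeroedn; ring.
Qed.

(** The norm of the group [Z/q] acting on cochains by shifts. *)
Definition orbit_sum Psi s : int := \sum_(a : Z) Psi (map (shift a) s).

Lemma map_shiftD a b s : map (shift a) (map (shift b) s) = map (shift (b + a)) s.
Proof. by rewrite -map_comp; apply: eq_map => x /=; rewrite shiftD. Qed.

Lemma orbit_sum_shift Psi b s : orbit_sum Psi (map (shift b) s) = orbit_sum Psi s.
Proof.
rewrite /orbit_sum [RHS](reindex_inj (addrI b)); apply: eq_bigr => a _.
by rewrite map_shiftD.
Qed.

Lemma cobd_orbit_sum Psi s : cobd (orbit_sum Psi) s = orbit_sum (cobd Psi) s.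
Proof. by rewrite cobd_sum; apply: eq_bigr => a _; rewrite cobd_map. Qed.

(** Cup products, on the left, with a 0-cochain [t] and with a 1-cochain [g]. *)
Definition cup0 (t : V -> int) Phi s : int := if s is x :: _ then t x * Phi s else 0.
Definition cup1 (g : V -> V -> int) Phi s : int :=
  if s is x :: (y :: _) as s' then g x y * Phi s' else 0.

Lemma cobd_cup0 t Phi s : (forall r, cobd Phi r = 0) ->
  cobd (cup0 t Phi) s = cup1 (fun x y => t y - t x) Phi s.
Proof.
move=> closed; case: s => [//|x [//|y s]].
have := closed [:: x, y & s].
have -> : cobd Phi [:: x, y & s] = Phi (y :: s) - cobd (fun r => Phi (x :: r)) (y :: s) by [].
have -> : cobd (cup0 t Phi) [:: x, y & s] =
  t y * Phi (y :: s) - cobd (fun r => t x * Phi (x :: r)) (y :: s) by [].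
rewrite cobdZ /= => /eqP; rewrite subr_eq0 => /eqP <-; ring.
Qed.

Lemma cobd_cup1 g Phi x y z s : (forall r, cobd Phi r = 0) ->
  cobd (cup1 g Phi) [:: x, y, z & s] = (g y z - g x z + g x y) * Phi (z :: s).
Proof.
move=> closed.
have -> : cobd (cup1 g Phi) [:: x, y, z & s] =
  g y z * Phi (z :: s) - cobd (fun r => cup1 g Phi (x :: r)) [:: y, z & s] by [].
rewrite (eq_cobd (Psi := cup0 (g x) Phi)); last by case.
by rewrite cobd_cup0 //=; ring.
Qed.

Definition equivariant (sg : V -> Z) := forall a x, sg (shift a x) = sg x + a.

(* [cobd (desc sg)] is the carry cocycle, the generator of the second cohomology of [Z/q]. *)
Definition desc (sg : V -> Z) x y : int := (sg y < sg x)%N%:R.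
(** This marks the words where [sg] wraps around to 0 under the shift by 1; its coboundary is the
    change of [desc sg] under that shift. *)
Definition lastv (sg : V -> Z) x : int := (sg x == -1)%:R.

Lemma desc_shift sg x y : equivariant sg ->
  desc sg (shift 1 x) (shift 1 y) = desc sg x y + (lastv sg y - lastv sg x).
Proof.
move=> eqv; rewrite /desc /lastv !eqv.
have lastE (u : Z) : (u == -1) = (u == Q.+1 :> nat).
  by apply/eqP/eqP => [->|h]; [exact: val_Zp_opp1 | apply: val_inj; exact: etrans h (esym (val_Zp_opp1 Q))].
rewrite !val_Zp_succ !lastE.
have := ltn_ord (sg x); have := ltn_ord (sg y).
move: (sg x : nat) (sg y : nat) => a b.
by case: (eqVneq a Q.+1) => [->|ha]; case: (eqVneq b Q.+1) => [->|hb] bQ aQ;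
 rewrite ?ltnn ?ltnS ?ltn0 ?subrr ?addr0 //=; lia.
Qed.

Lemma sum_lastv sg x : equivariant sg -> \sum_(a : Z) lastv sg (shift a x) = 1.
Proof.
move=> eqv; rewrite (bigD1 (-1 - sg x)) //= /lastv eqv addrCA subrr addr0 eqxx big1 ?addr0 // => a.
by rewrite eqv [a == _]eq_sym subr_eq [a + _]addrC eq_sym => /negPf->.
Qed.

(* a cup product of carry cocycles, one for each section *)
Fixpoint obstr (sec : seq (V -> Z)) : seq V -> int :=
  if sec is sg :: sec' then cobd (cup1 (desc sg) (obstr sec')) else cobd (fun=> 1).

Lemma cobd_obstr sec s : cobd (obstr sec) s = 0.
Proof. by case: sec => [|sg sec]; apply: cobdK. Qed.

Lemma cup1_desc_shift sg sec s : equivariant sg ->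
  (forall r, obstr sec (map (shift 1) r) = obstr sec r) ->
  cup1 (desc sg) (obstr sec) (map (shift 1) s) =
    cup1 (desc sg) (obstr sec) s + cobd (cup0 (lastv sg) (obstr sec)) s.
Proof.
move=> eqv inv; rewrite cobd_cup0; last exact: cobd_obstr.
case: s => [|x [|y s]] //=.
by rewrite desc_shift // (inv (y :: s)); ring.
Qed.

(** Inductively, the shift changes the cochain under [cobd] by a coboundary, which [cobdK] kills. *)
Lemma obstr_shift sec s : (forall sg, List.In sg sec -> equivariant sg) ->
  obstr sec (map (shift 1) s) = obstr sec s.
Proof.
elim: sec s => [|sg sec IHsec] s eqv /=; first by rewrite -cobd_map.
rewrite -cobd_map (eq_cobd (Psi := fun r => cup1 (desc sg) (obstr sec) r +
  cobd (cup0 (lastv sg) (obstr sec)) r)); first by rewrite cobdD cobdK addr0.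
move=> r; apply: cup1_desc_shift; first by apply: eqv; left.
by move=> r'; apply: IHsec => g gs; apply: eqv; right.
Qed.

Lemma obstr_shift_all sec a s : (forall sg, List.In sg sec -> equivariant sg) ->
  obstr sec (map (shift a) s) = obstr sec s.
Proof.
move=> eqv; rewrite -[a]natr_Zp; elim: (a : nat) => [|k IHk].
  by rewrite (eq_map (shift0 : shift 0 =1 id)) map_id.
by rewrite mulrSr -map_shiftD obstr_shift.
Qed.

(** A section constant on [s] makes its carry factor vanish, and with it the product. The induction
    drops the first two entries with each factor. *)
Lemma obstr_eq0 sec s : (forall sg, List.In sg sec -> equivariant sg) ->
  size s = (size sec).*2.+1 ->
  (exists2 sg, List.In sg sec & forall x y, x \in s -> y \in s -> sg x = sg y) ->
  obstr sec s = 0.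
Proof.
elim: sec s => [|sg sec IHsec] s eqv /= sz [g]; first by [].
case: s sz => [|x [|y [|z s]]] //= [sz] g_in cst.
rewrite -[LHS]/(cobd (cup1 (desc sg) (obstr sec)) [:: x, y, z & s]).
rewrite cobd_cup1; last exact: cobd_obstr.
case: g_in => [eg | g_in].
  have e : sg x = sg y /\ sg y = sg z.
    by rewrite eg; split; apply: cst; rewrite !inE eqxx ?orbT.
  rewrite /desc !e.1 !e.2 ltnn subrK; exact: mul0r.
rewrite IHsec ?mulr0 //=.
- by move=> h hs; apply: eqv; right.
- by rewrite sz.
exists g => // u v us vs; apply: cst; rewrite !inE; move: us vs; rewrite !inE.
  by case/orP => ->; rewrite ?orbT.
by move=> _ /orP[] ->; rewrite ?orbT.
Qed.

(* In the cohomology of [Z/q], the top cup product is the coboundary of an orbit sum only if the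
   previous one is.  At the bottom the constant 1 would be a multiple of [q]. *)
Lemma obstr_not_orbit_sum sec d : (forall sg, List.In sg sec -> equivariant sg) ->
  ((size sec).*2 <= d)%N ->
  ~ exists Psi, forall s, small d s -> size s = (size sec).*2.+1 ->
    obstr sec s = cobd (orbit_sum Psi) s.
Proof.
elim: sec d => [|sg sec IHsec] d eqv /=.
  move=> _ [Psi hPsi]; pose o : V := [ffun=> 0].
  have: (1 : int) = Psi [::] *+ Q.+2.
    have sm_o : small d [:: o] by move=> x y; rewrite !inE => /eqP-> /eqP->; rewrite hdistxx.
    have := hPsi _ sm_o erefl; rewrite /= !subr0 => ->.
    by rewrite /orbit_sum /= sumr_const card_ord.
  rewrite -mulr_natr => /(congr1 absz); rewrite abszM natz absz_nat => /eqP.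
  by rewrite eq_sym muln_eq1 andbF.
case: d => [//|[//|d]]; rewrite doubleS !ltnS => le_d [Psi hPsi].
have eqv' g : List.In g sec -> equivariant g by move=> gs; apply: eqv; right.
have eqv_sg : equivariant sg by apply: eqv; left.
pose T1 := cup1 (desc sg) (obstr sec); pose T0 := cup0 (lastv sg) (obstr sec).
(* [cobd T1] is the obstruction, so [T1 - orbit_sum Psi] is closed on small lists and can be
   filled. *)
have [|Psi1 hPsi1] := @acyclic (fun s => T1 s - orbit_sum Psi s) d.+1 (size sec).*2.+1.
  move=> s sm sz; rewrite cobdB; apply/eqP; rewrite subr_eq0; apply/eqP.
  by apply: hPsi => //; rewrite sz.
pose DPsi1 s := Psi1 (map (shift 1) s) - Psi1 s.
(* Under the shift by 1, [T1] changes by [cobd T0] and the orbit sum does not change; hence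
   [T0 - DPsi1] is closed as well. *)
have [|Psi2 hPsi2] := @acyclic (fun s => T0 s - DPsi1 s) d (size sec).*2.
  move=> s sm sz; rewrite !cobdB (cobd_map (shift 1) Psi1) !hPsi1 ?size_map //; last exact: small_shift.
  rewrite orbit_sum_shift /T1 cup1_desc_shift //; last by move=> r; apply: obstr_shift.
  by rewrite -/T0 -/T1; ring.
apply: (IHsec d) => //; exists Psi2 => s sm sz.
rewrite cobd_orbit_sum /orbit_sum (eq_bigr (fun a => T0 (map (shift a) s) - DPsi1 (map (shift a) s))); last first.
  by move=> a _; rewrite hPsi2 ?size_map //; exact: small_shift.
rewrite big_split /= sumrN.
(* Over a full orbit the changes of [Psi1] cancel, and the weights [lastv] in [T0] add up to 1,
   which leaves [obstr sec]. *)
have -> : \sum_(a : Z) DPsi1 (map (shift a) s) = 0.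
  rewrite /DPsi1 big_split /= sumrN; apply/eqP; rewrite subr_eq0; apply/eqP.
  rewrite [RHS](reindex_inj (addIr 1)); apply: eq_bigr => a _.
  by rewrite map_shiftD.
rewrite subr0; case: s sm sz => [//|x s] sm sz.
rewrite -[LHS]mul1r -(sum_lastv x eqv_sg) mulr_suml; apply: eq_bigr => a _.
by rewrite -(obstr_shift_all a (x :: s)).
Qed.

(* If the sections were locally constant in turn, their [obstr] would vanish on small lists. *)
Lemma no_local_sections (sec : seq (V -> Z)) d :
  (forall sg, List.In sg sec -> equivariant sg) -> ((size sec).*2 <= d)%N ->
  ~ (forall s, small d s -> exists2 sg, List.In sg sec &
       forall x y, x \in s -> y \in s -> sg x = sg y).
Proof.
move=> eqv le_d loc; apply: (obstr_not_orbit_sum eqv le_d); exists (fun=> 0) => s sm sz.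
rewrite cobd_orbit_sum /orbit_sum big1; last by move=> a _; apply: cobd0.
by apply: obstr_eq0 => //; apply: loc.
Qed.

End Words.

(** * Chromatic number of rotation graphs *)

Lemma In_map (T : eqType) (U : Type) (g : T -> U) (s : seq T) (h : U) :
  List.In h (map g s) <-> exists2 i, i \in s & h = g i.
Proof.
elim: s => [|i s IHs] /=; first by split=> // -[].
split=> [[<-|/IHs[j js ->]]|[j]].
- by exists i; rewrite ?mem_head.
- by exists j; rewrite // inE js orbT.
by rewrite inE => /predU1P[-> ->|js hj]; [left | right; apply/IHs; exists j].
Qed.

(** Strict growth at each of the first [m] steps would give [m + 1 <= a m]. *)
Lemma stationary (a : nat -> nat) m : (forall j, (a j <= a j.+1)%N) ->
  (0 < a 0%N)%N -> (a m < m.+1)%N -> exists2 j, (j < m)%N & a j = a j.+1.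
Proof.
move=> a_mono; elim: m => [|m IHm] a0 am; first by lia.
have := a_mono m; rewrite leq_eqVlt => /predU1P[e|lt_a]; first by exists m.
have [|j jm e] := IHm a0; first by lia.
by exists j => //; apply: ltnW.
Qed.

Section WordChromatic.
Variables (n Q C : nat).
Local Notation Z := 'I_Q.+2.
Local Notation V := {ffun 'I_n.+1 -> Z}.
Variable f : V -> 'I_C.

(** An element of [Z/q] that moves with the translates of [D]; for prime [q] and [0 < #|D| < q] the
    division is legitimate. *)
Definition mean (D : {set Z}) : Z := (\sum_(s in D) s) / #|D|%:R.

Lemma mean_translate (D : {set Z}) a : prime Q.+2 -> (0 < #|D| < Q.+2)%N ->
  mean [set s | a + s \in D] = mean D - a.
Proof.
move=> Q_prime /andP[D_gt0 D_lt].
have imD : [set s | a + s \in D] = [set s - a | s in D].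
  apply/setP => s; rewrite inE; apply/idP/imsetP => [sD|[u uD ->]]; last by rewrite addrC subrK.
  by exists (a + s) => //; rewrite addrC addKr.
have cardD : #|[set s | a + s \in D]| = #|D| by rewrite imD card_imset //; apply: addIr.
have unitD : (#|D|%:R : Z) \is a GRing.unit.
  have := @unitZpE Q.+2 #|D| isT; rewrite /= => ->.
  rewrite prime_coprime //; apply/negP => /(dvdn_leq D_gt0); lia.
rewrite /mean cardD imD big_imset /=; last by move=> u v _ _; apply: addIr.
by rewrite big_split /= sumrN sumr_const mulrBl -[a *+ _]mulr_natr mulrK.
Qed.

Definition reach (r : nat) (c : 'I_C) (x : V) : {set Z} :=
  [set s | [exists y, (hdist x y <= r)%N && (f (shift s y) == c)]].

Lemma reach_shift r c a x : reach r c (shift a x) = [set s | a + s \in reach r c x].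
Proof.
apply/setP => s; rewrite !inE; apply/existsP/existsP => -[y /andP[xy fy]].
  exists (shift (- a) y); rewrite -(hdist_shift a) !shiftD addNr shift0 xy /=.
  by rewrite addKr.
by exists (shift a y); rewrite hdist_shift xy shiftD.
Qed.

Lemma reach_le r r' c x x' : (hdist x x' + r <= r')%N -> reach r c x \subset reach r' c x'.
Proof.
move=> le_r; apply/subsetP => s; rewrite !inE => /existsP[y /andP[xy fy]].
apply/existsP; exists y; rewrite fy andbT; apply: leq_trans le_r.
apply: leq_trans (hdist_triangle x' x y) _; rewrite hdistC; lia.
Qed.

(** The sign is there because the shift by [a] translates [reach r c x] by [- a]. When that set is
    empty or everything, the first letter is an arbitrary equivariant default. *)
Definition reach_mean (r : nat) (c : 'I_C) (x : V) : Z :=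
  if (0 < #|reach r c x| < Q.+2)%N then - mean (reach r c x) else x ord0.

Lemma reach_mean_equivariant r c : prime Q.+2 -> equivariant (reach_mean r c).
Proof.
move=> Q_prime a x; rewrite /reach_mean.
have -> : #|reach r c (shift a x)| = #|reach r c x|.
  rewrite reach_shift; rewrite -[RHS](card_imset _ (addrI (- a))).
  apply: eq_card => s; rewrite inE; apply/idP/imsetP => [sD|[u uD ->]].
    by exists (a + s); rewrite // addKr.
  by rewrite addNKr.
case: ifP => [D_proper|_]; last by rewrite ffunE.
by rewrite reach_shift mean_translate // opprB addrC.
Qed.

(* For [c = f x0], the sets [reach r c x0] increase with [r], contain 0 and miss 1.  Hence they are
   stationary between two consecutive radii, and [reach_mean] is constant near [x0] at the radius
   in between. *)
Lemma word_chromatic : prime Q.+2 ->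
  exists x y : V, (hdist (shift 1%R x) y <= 4 * Q.+2 ^ 2 * C)%N /\ f x = f y.
Proof.
move=> Q_prime; set t := (4 * _ * _)%N.
(* There will be [q C] sections, and [no_local_sections] wants [d] to be at least twice their
   number; [t = 2 q d] bounds every radius used. *)
pose d := (2 * (Q.+2 * C))%N.
case: (pickP (fun p : V * V => (hdist (shift 1%R p.1) p.2 <= t)%N && (f p.1 == f p.2))).
  by move=> [x y] /= /andP[xy /eqP fxy]; exists x, y.
move=> no_edge; exfalso.
have proper x r : (r <= t)%N -> 1 \notin reach r (f x) x.
  move=> rt; rewrite inE; apply/existsP => -[y /andP[xy fy]].
  by have := no_edge (x, shift 1 y); rewrite /= hdist_shift (leq_trans xy rt) eq_sym fy.
pose idx : seq (nat * 'I_C) := [seq (j, c) | j <- iota 0 Q.+2, c <- enum 'I_C].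
pose sec := [seq reach_mean (p.1.*2.+1 * d) p.2 | p <- idx].
apply: (@no_local_sections n.+1 Q sec d).
- by move=> sg /In_map[p _ ->]; apply: reach_mean_equivariant.
- by rewrite size_map size_allpairs size_iota size_enum_ord /d; lia.
move=> s sm; pose x0 := head [ffun=> 0] s.
have x0P x : x \in s -> (hdist x0 x <= d)%N.
  by move=> xs; apply: sm => //; rewrite /x0; case: (s) xs => // z l _; rewrite mem_head.
pose a j := #|reach (j.*2 * d) (f x0) x0|.
have [||| j jQ aj] := @stationary a Q.+2.
- by move=> j; apply/subset_leq_card/reach_le; rewrite hdistxx doubleS; lia.
- apply/card_gt0P; exists 0; rewrite inE; apply/existsP; exists x0.
  by rewrite hdistxx shift0 eqxx.
- rewrite ltnS; apply: leq_trans (max_card _) _; by rewrite card_ord.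
have le_t : (j.+1.*2 * d <= t)%N.
  by apply: (@leq_trans (Q.+2.*2 * d)%N); [rewrite leq_mul2r; lia | rewrite /t /d; nia].
set E := reach (j.+1.*2 * d) (f x0) x0.
(* This radius is [d] away from the two stationary ones, which absorbs the distance from [x0] to
   [x]; the set is squeezed between two equal sets. *)
have eqE x : x \in s -> reach (j.*2.+1 * d) (f x0) x = E.
  move=> xs; have x0x := x0P x xs.
  have sub1 : reach (j.*2 * d) (f x0) x0 \subset reach (j.*2.+1 * d) (f x0) x.
    by apply: reach_le; rewrite mulSn; lia.
  have sub2 : reach (j.*2.+1 * d) (f x0) x \subset E.
    by apply: reach_le; rewrite hdistC doubleS mulSn; lia.
  apply/eqP; rewrite eqEcard sub2 /=; rewrite -[#|E|]/(a j.+1) -aj; exact: subset_leq_card.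
have E_proper : (0 < #|E| < Q.+2)%N.
  apply/andP; split; first apply/card_gt0P.
    exists 0; rewrite inE; apply/existsP; exists x0; by rewrite hdistxx shift0 eqxx.
  rewrite -[X in (_ < X)%N](card_ord Q.+2) -cardsT; apply: proper_card.
  rewrite properT; apply: contraNneq (proper x0 _ le_t) => ET; by rewrite -/E ET inE.
exists (reach_mean (j.*2.+1 * d) (f x0)).
  apply/In_map; exists (j, f x0) => //=; apply/allpairsP; exists (j, f x0).
  by rewrite mem_iota jQ mem_enum.
by move=> x y xs ys; rewrite /reach_mean !eqE // E_proper.
Qed.

End WordChromatic.

(** * Moments and dense rotation-free sets *)

(** Cauchy-Schwarz against the constant 1, read off from the variance being non-negative. *)
Lemma sum_sqr_le (R : realDomainType) (I : finType) (P : pred I) (a : I -> R) :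
  (\sum_(i | P i) a i) ^+ 2 <= #|P|%:R * \sum_(i | P i) a i ^+ 2.
Proof.
have [P0|P0] := posnP #|P|.
  rewrite P0 mul0r big_pred0 ?expr0n // => i; apply/negP => Pi.
  by have := card0_eq P0 i; rewrite unfold_in Pi.
set S := \sum_(i | P i) a i; set S2 := \sum_(i | P i) _.
have : 0 <= \sum_(i | P i) (#|P|%:R * a i - S) ^+ 2 by apply: sumr_ge0 => i _; apply: sqr_ge0.
rewrite (eq_bigr (fun i => #|P|%:R ^+ 2 * a i ^+ 2 - (#|P|%:R * S *+ 2) * a i + S ^+ 2)); last by move=> i _; ring.
rewrite !big_split /= sumrN -!mulr_sumr sumr_const -/S -/S2.
rewrite -[S *+ #|P|]mulr_natl (_ : _ + _ = #|P|%:R * (#|P|%:R * S2 - S ^+ 2)); last by ring.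
by rewrite pmulr_rge0 ?ltr0n // subr_ge0.
Qed.

Section Cons.
Variables (T : finType) (n : nat).

Definition fcons (a : T) (w : {ffun 'I_n -> T}) : {ffun 'I_n.+1 -> T} :=
  [ffun i => if unlift ord0 i is Some j then w j else a].

Lemma fcons0 a w : fcons a w ord0 = a.
Proof. by rewrite ffunE unlift_none. Qed.

Lemma fconsS a w i : fcons a w (lift ord0 i) = w i.
Proof. by rewrite ffunE liftK. Qed.

Lemma sum_fcons (R : nmodType) (G : {ffun 'I_n.+1 -> T} -> R) :
  \sum_v G v = \sum_a \sum_w G (fcons a w).
Proof.
rewrite pair_big /= (reindex (fun p : T * {ffun 'I_n -> T} => fcons p.1 p.2)) //.
exists (fun v : {ffun _} => (v ord0, [ffun i => v (lift ord0 i)])) => [[a w] _ | v _] /=.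
  by rewrite fcons0; congr (_, _); apply/ffunP => i; rewrite ffunE fconsS.
apply/ffunP => i; rewrite ffunE; case: unliftP => [j ->|-> //]; exact: ffunE.
Qed.

Lemma sum_ord_fcons (R : nmodType) (h : T -> R) a w :
  \sum_i h (fcons a w i) = h a + \sum_i h (w i).
Proof. by rewrite big_ord_recl fcons0; under eq_bigr => i _ do rewrite fconsS. Qed.

End Cons.

Section Moments.
Variables (T : finType) (R : comNzRingType) (phi : T -> R).
Local Notation N := (#|T|%:R : R).

Definition moment (e n : nat) : R := \sum_(v : {ffun 'I_n -> T}) (\sum_i phi (v i)) ^+ e.

Lemma moment0n n : moment 0 n = N ^+ n.
Proof.
rewrite /moment (eq_bigr (fun=> 1)) // sumr_const -natrX -[#|_|]/#|{: {ffun _}}|.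
by rewrite card_ffun card_ord.
Qed.

Lemma momentn0 e : moment e.+1 0 = 0.
Proof. by rewrite /moment big1 // => v _; rewrite big_ord0 expr0n. Qed.

Definition psum (j : nat) : R := \sum_a phi a ^+ j.

Lemma psum0 : psum 0 = N.
Proof. by rewrite /psum sumr_const. Qed.

(** Split off the first letter and expand by the binomial theorem. *)
Lemma momentS e n : moment e n.+1 = \sum_(i < e.+1) (psum (e - i) * moment i n) *+ 'C(e, i).
Proof.
rewrite /moment sum_fcons.
under eq_bigr => a _ do under eq_bigr => w _ do rewrite sum_ord_fcons exprDn.
under eq_bigr => a _ do rewrite exchange_big /=.
rewrite exchange_big /=; apply: eq_bigr => i _.
rewrite /psum mulr_suml -sumrMnl; apply: eq_bigr => a _.
by rewrite sumrMnl mulr_sumr.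
Qed.

Hypothesis psum1 : psum 1 = 0.

Lemma moment2 n : moment 2 n.+1 = N * moment 2 n + psum 2 * N ^+ n.
Proof.
transitivity (psum 2 * moment 0 n *+ 1 + (psum 1 * moment 1 n *+ 2 + (psum 0 * moment 2 n *+ 1 + 0))).
  by rewrite momentS !big_ord_recl big_ord0.
by rewrite psum0 psum1 moment0n; ring.
Qed.

Hypothesis psum3 : psum 3 = 0.

Lemma moment4 n : moment 4 n.+1 = N * moment 4 n + psum 2 * moment 2 n *+ 6 + psum 4 * N ^+ n.
Proof.
transitivity (psum 4 * moment 0 n *+ 1 + (psum 3 * moment 1 n *+ 4 + (psum 2 * moment 2 n *+ 6
  + (psum 1 * moment 3 n *+ 4 + (psum 0 * moment 4 n *+ 1 + 0))))).
  by rewrite momentS !big_ord_recl big_ord0.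
by rewrite psum0 psum1 psum3 moment0n; ring.
Qed.

End Moments.

Section Spread.
Variable Q : nat.
Local Notation q := Q.+2.
Local Notation Z := 'I_q.

(** Letters 0 and 1 are opposite votes and the others abstain, so odd power sums vanish. *)
Definition vote (a : Z) : int := (a == 0)%:R - (a == 1)%:R.
Definition votes n (v : {ffun 'I_n -> Z}) : int := \sum_i vote (v i).

Lemma psum_vote j : psum vote j.+1 = 1 + (-1) ^+ j.+1.
Proof.
rewrite /psum (bigD1 0) //= (bigD1 1) //= big1; last first.
  by move=> a /andP[/negPf a0 /negPf a1]; rewrite /vote a0 a1 subrr expr0n.
by rewrite /vote !eqxx /= subr0 sub0r expr1n addr0.
Qed.

Lemma moment2_vote n : moment vote 2 n * q%:R = (n.*2 * q ^ n)%:R.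
Proof.
elim: n => [|n IHn]; first by rewrite momentn0 mul0r.
rewrite moment2 ?(psum_vote 0) // psum_vote mulrDl -mulrA IHn card_ord.
rewrite doubleS -!natrX -natrM -[1 + _]/(2%:R) -!natrM -natrD expnS; congr (_%:R); lia.
Qed.

Lemma moment4_vote n : moment vote 4 n * q%:R ^+ 2 <= ((12 * n ^ 2 + 2 * q * n) * q ^ n)%:R.
Proof.
elim: n => [|n IHn]; first by rewrite momentn0 mul0r.
rewrite moment4 ?(psum_vote 0) ?(psum_vote 2) // card_ord (psum_vote 1) (psum_vote 3) -[1 + (-1) ^+ 2]/(2%:R : int).
have e2 := moment2_vote n.
have -> : (q%:R * moment vote 4 n + 2%:R * moment vote 2 n *+ 6 + 2%:R * q%:R ^+ n) * q%:R ^+ 2 =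
  q%:R * (moment vote 4 n * q%:R ^+ 2) + 12%:R * (moment vote 2 n * q%:R) * q%:R + 2%:R * q%:R ^+ n * q%:R ^+ 2 :> int.
  by ring.
rewrite e2; apply: le_trans (lerD (lerD (ler_wpM2l _ IHn) (lexx _)) (lexx _)) _; first exact: ler0n.
rewrite -!natrX -!natrM -!natrD ler_nat.
set X := (q ^ n)%N.
have -> : (q * ((12 * n ^ 2 + 2 * q * n) * X) + 12 * (n.*2 * X) * q + 2 * X * q ^ 2 =
  (q * X) * (12 * n ^ 2 + 2 * q * n + 24 * n + 2 * q))%N by rewrite -muln2; ring.
rewrite (expnS q n) [leqLHS]mulnC leq_mul2r; apply/orP; right; nia.
Qed.

(* Paley-Zygmund: the second moment of [votes] is comparable to the root of the fourth. *)
Lemma spread_card n : (q <= n)%N ->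
  (q ^ n <= 14 * #|[set v : {ffun 'I_n -> Z} | (n%:Z < q%:Z * votes v ^+ 2)%R]|)%N.
Proof.
move=> qn; set G := [set v | _].
have n_gt0 : (0 < n)%N by apply: leq_trans qn.
have m2 : moment vote 2 n = \sum_(v : {ffun 'I_n -> Z}) votes v ^+ 2 by [].
have m4 : moment vote 4 n = \sum_(v : {ffun 'I_n -> Z}) votes v ^+ 4 by [].
(* By [moment2_vote] the sum over all words is twice the right side, and words outside [G] account
   for at most half of it. *)
have lowG : q%:Z * (\sum_(v in G) votes v ^+ 2) >= (n * q ^ n)%:Z.
  have : q%:Z * moment vote 2 n = (n.*2 * q ^ n)%:Z by rewrite mulrC -[q%:Z]natz moment2_vote natz.
  rewrite m2 (bigID (mem G)) /= mulrDr => e.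
  have : q%:Z * (\sum_(v | v \notin G) votes v ^+ 2) <= (n * q ^ n)%:Z.
    rewrite mulr_sumr; apply: (@le_trans _ _ (\sum_(v : {ffun 'I_n -> Z} | v \notin G) n%:Z)).
      by apply: ler_sum => v; rewrite inE -leNgt.
    rewrite sumr_const -mulr_natl natz -PoszM lez_nat mulnC leq_mul2l.
    apply/orP; right; apply: leq_trans (max_card _) _; by rewrite card_ffun !card_ord.
  move: e; rewrite -addnn mulnDl PoszD.
  move: (n * q ^ n)%N%:Z (q%:Z * _) (q%:Z * _) => X Y W; lra.
have cs := @sum_sqr_le int _ (mem G) (fun v : {ffun 'I_n -> Z} => votes v ^+ 2).
have up4 : \sum_(v in G) (votes v ^+ 2) ^+ 2 <= moment vote 4 n.
  rewrite m4 [leRHS](bigID (mem G)) /= ler_wpDr //.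
    by apply: sumr_ge0 => v _; rewrite (exprM _ 2 2) sqr_ge0.
  by apply: ler_sum => v _; rewrite -exprM.
have m4le := moment4_vote n.
have h1 : (n * q ^ n)%:Z ^+ 2 <= q%:Z ^+ 2 * (#|G|%:Z * moment vote 4 n).
  apply: (@le_trans _ _ (q%:Z ^+ 2 * (\sum_(v in G) votes v ^+ 2) ^+ 2)).
    rewrite -exprMn ler_sqr ?nnegrE //; apply: mulr_ge0 => //.
    by apply: sumr_ge0 => v _; apply: sqr_ge0.
  rewrite ler_wpM2l ?sqr_ge0 //; apply: le_trans cs _.
  by rewrite natz ler_wpM2l.
(* Since [q <= n], the factor [12 n ^ 2 + 2 q n] is at most [14 n ^ 2]. *)
have h2 : (n * q ^ n)%:Z ^+ 2 <= (#|G| * (14 * n ^ 2 * q ^ n))%:Z.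
  apply: le_trans h1 _; rewrite mulrCA PoszM ler_wpM2l // [leLHS]mulrC -[q%:Z]natz.
  apply: le_trans m4le _; rewrite natz lez_nat leq_mul2r; apply/orP; right; nia.
have X_gt0 : (0 < q ^ n)%N by rewrite expn_gt0.
move: h2; rewrite expr2 -PoszM lez_nat; move: (q ^ n)%N X_gt0 (#|G|) => X X0 g; nia.
Qed.

End Spread.

Lemma card_le_cover (T I : finType) (G : {set T}) (F : I -> {set T}) :
  (forall x, x \in G -> exists i, x \in F i) -> (#|G| <= \sum_i #|F i|)%N.
Proof.
move=> cover; under eq_bigr => i _ do rewrite -sum1_card big_mkcond.
rewrite exchange_big -sum1_card [leqLHS]big_mkcond; apply: leq_sum => x _.
case: ifP => // /cover[i xi]; by rewrite (bigD1 i) //= xi.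
Qed.

Section Rotation.
Variable Q : nat.
Local Notation q := Q.+2.
Local Notation Z := 'I_q.

Definition tally n (v : {ffun 'I_n -> Z}) (a : Z) : nat := #|[set i | v i == a]|.

Lemma votes_tally n (v : {ffun 'I_n -> Z}) : votes v = (tally v 0)%:Z - (tally v 1)%:Z.
Proof.
rewrite /votes /vote sumrB /tally -!sum1_card -!natz !natr_sum.
by congr (_ - _); rewrite [RHS]big_mkcond; apply: eq_bigr => i _; rewrite inE; case: eqP.
Qed.

Lemma sum_tally n (v : {ffun 'I_n -> Z}) : (\sum_a tally v a)%N = n.
Proof.
rewrite -[RHS]card_ord -sum1_card (partition_big v xpredT) //=; apply: eq_bigr => a _.
by rewrite /tally -sum1_card; apply: eq_bigl => i; rewrite inE.
Qed.

Lemma tally_shift n (v : {ffun 'I_n -> Z}) a b : tally (shift b v) a = tally v (a - b).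
Proof. by apply: eq_card => i; rewrite !inE ffunE eq_sym -subr_eq eq_sym. Qed.

Lemma tally_hdist n (v w : {ffun 'I_n -> Z}) a : (tally v a <= tally w a + hdist w v)%N.
Proof.
apply: leq_trans (leq_card_setU _ _); apply/subset_leq_card/subsetP => i.
by rewrite !inE => /eqP->; rewrite orbN.
Qed.

Definition level n (m T : nat) : {set {ffun 'I_n -> Z}} :=
  [set v | (m + T <= tally v 0%R)%N && (tally v (-1)%R < m)%N].

(** The letters -1 of [v] become the zeros of its shift, which has fewer than [m] of them, while [w]
    has at least [m + T]. *)
Lemma level_free n m T (v w : {ffun 'I_n -> Z}) : v \in level n m T -> w \in level n m T ->
  (T < hdist (shift 1%R v) w)%N.
Proof.
rewrite !inE => /andP[_ v1] /andP[w0 _].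
have := tally_hdist w (shift 1 v) 0; rewrite tally_shift sub0r.
move: (hdist _ _) (tally w _) (tally v _) v1 w0 => h x y; lia.
Qed.

(** Walking around [Z/q] from [b] in steps of 1 meets [a], so the tallies must pass [m] on the
    way. *)
Lemma crossing n (v : {ffun 'I_n -> Z}) m a b : (tally v b < m <= tally v a)%N ->
  exists c, (tally v c < m <= tally v (c + 1)%R)%N.
Proof.
case/andP=> bm ma; apply/existsP; apply: contraLR (ma); rewrite negb_exists -ltnNge => /forallP no_c.
suff below k : (tally v (b + k%:R)%R < m)%N.
  by have := below (a - b : Z); rewrite natr_Zp addrC subrK.
elim: k => [|k IHk]; first by rewrite addr0.
by have := no_c (b + k%:R); rewrite IHk /= -ltnNge mulrSr addrA.
Qed.

(** If every tally were below [n / q + T], their fixed sum would keep any two of them within [q T],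
    and the vote, a difference of two tallies, would be too small. *)
Lemma far_tally n (v : {ffun 'I_n -> Z}) T : (0 < T)%N ->
  n%:Z < q%:Z * votes v ^+ 2 -> (q * (q * T) ^ 2 <= n)%N ->
  exists a, (n %/ q + T <= tally v a)%N.
Proof.
move=> T_gt0 vn Tn; apply/existsP; apply: contraLR vn; rewrite negb_exists -leNgt => /forallP small_v.
have bound a b : (tally v a + (q * T) <= tally v b -> a != b -> False)%N.
  move=> ab anb; have := sum_tally v; rewrite (bigD1 a) //=.
  have le_b : (tally v a <= n %/ q + T.-1 - q * T)%N.
    by have := small_v b; rewrite -ltnNge; lia.
  have : (\sum_(i | i != a) tally v i <= \sum_(i : Z | i != a) (n %/ q + T.-1))%N.
    by apply: leq_sum => i _; have := small_v i; rewrite -ltnNge; lia.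
  rewrite sum_nat_const cardC1 card_ord /=.
  have := leq_trunc_div n q; have := small_v b; have := small_v a; rewrite -!ltnNge.
  move: (\sum_(i | _) _)%N => S; rewrite mulnC; nia.
apply: le_trans (_ : (q * (q * T) ^ 2)%:Z <= _); last by rewrite lez_nat.
rewrite PoszM ler_wpM2l // votes_tally.
have b01 : (tally v 0%R < tally v 1%R + q * T)%N.
  by rewrite ltnNge; apply/negP => /bound; apply.
have b10 : (tally v 1%R < tally v 0%R + q * T)%N.
  by rewrite ltnNge; apply/negP => /bound; apply.
move: b01 b10; move: (q * T)%N (tally v 0) (tally v 1) => D x y; nia.
Qed.

(* When the tallies of [v] are spread out, one of [q + 1] thresholds is crossed with a gap at least
   [T] between two cyclically consecutive tallies, so a shift of [v] lies in the matching [level]. *)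
Lemma rotation_free_set T n0 : exists n (E : {set {ffun 'I_n.+1 -> Z}}),
  [/\ (n0 <= n)%N, (q ^ n.+1 <= 14 * q * q.+1 * #|E|)%N &
      forall v w, v \in E -> w \in E -> (T < hdist (shift 1%R v) w)%N].
Proof.
(* [T'] leaves room for [q + 1] thresholds [m i] spaced by [T + 1], all above the mean tally. *)
pose T' := (q.+1 * T.+1)%N; pose n := (n0 + q + q * (q * T') ^ 2)%N.
pose m i := (n.+1 %/ q + 1 + i * T.+1)%N.
exists n; pose E (i : 'I_q.+1) := level n.+1 (m i) T.
have [b0 maxE] : {i | forall j, #|E j| <= #|E i|}%N.
  have [i _ maxE] := @arg_maxnP _ ord0 xpredT (fun i => #|E i|) isT.
  by exists i => j; apply: maxE.
exists (E b0); split; [by rewrite /n; lia | | by move=> v w; apply: level_free].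
set G := [set v : {ffun 'I_n.+1 -> Z} | (n.+1%:Z < q%:Z * votes v ^+ 2)%R].
have cardG : (q ^ n.+1 <= 14 * #|G|)%N by apply: spread_card; rewrite /n; lia.
have cover v : v \in G -> exists p : 'I_q.+1 * Z, v \in shift p.2 @^-1: E p.1.
  rewrite inE => vG; have [|| a va] := @far_tally _ v T' _ vG; try by rewrite /T' /n; lia.
  pose blocking (j : 'I_q.+1) c := (m j <= tally v c < m j + T)%N.
  (* The windows from [m j] to [m j + T] are disjoint, so each of the [q] tallies blocks at most one
     of the [q + 1] thresholds. *)
  have [j /forallP no_block] : exists j, [forall c, ~~ blocking j c].
    case: (boolP [exists j, [forall c, ~~ blocking j c]]) => [/existsP//|].
    rewrite negb_exists => /forallP all_block.
    have has_block j : exists c, blocking j c.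
      by have := all_block j; rewrite negb_forall => /existsP[c]; rewrite negbK; exists c.
    pose c j := xchoose (has_block j).
    have c_inj : injective c.
      move=> j1 j2 e; have := xchooseP (has_block j1); have := xchooseP (has_block j2).
      rewrite -/(c j1) -/(c j2) e /blocking /m; move: (tally v _) (n.+1 %/ q + 1)%N => t M h1 h2.
      have lt12 : (j1 * T.+1 < j2.+1 * T.+1)%N.
        by rewrite mulSn; move: (j1 * _)%N (j2 * _)%N h1 h2 => x y; lia.
      have lt21 : (j2 * T.+1 < j1.+1 * T.+1)%N.
        by rewrite mulSn; move: (j1 * _)%N (j2 * _)%N h1 h2 => x y; lia.
      apply: val_inj => /=; move: lt12 lt21; rewrite !ltn_pmul2r //; lia.
    by have := leq_card c c_inj; rewrite !card_ord ltnn.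
  have [b vb] : exists b, (tally v b <= n.+1 %/ q)%N.
    case: (boolP [exists b, (tally v b <= n.+1 %/ q)%N]) => [/existsP//|].
    rewrite negb_exists => /forallP large_v.
    have : (\sum_(i : Z) (n.+1 %/ q).+1 <= \sum_i tally v i)%N.
      by apply: leq_sum => i _; have := large_v i; rewrite -ltnNge.
    rewrite sum_tally sum_nat_const card_ord => le_n.
    by have := ltn_ceil n.+1 (isT : 0 < q)%N; rewrite mulnC ltnNge le_n.
  have [|c /andP[vc vc1]] := @crossing _ v (m j) a b.
    rewrite /m; apply/andP; split; first by lia.
    apply: leq_trans va; rewrite -addnA leq_add2l; apply: (@leq_trans (j.+1 * T.+1)); last by rewrite leq_mul2r ltn_ord.
    by rewrite mulSn leq_add2r.
  (* This shift moves the letter [c + 1] to 0 and [c] to -1. *)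
  exists (j, - (c + 1)); rewrite !inE !tally_shift /= sub0r !opprK addrCA addNr addr0 vc andbT.
  by have := no_block (c + 1); rewrite /blocking vc1 /= -leqNgt.
apply: leq_trans cardG _; rewrite -!mulnA leq_mul2l /=.
apply: leq_trans (card_le_cover cover) _.
rewrite -(pair_big xpredT xpredT (fun i a => #|shift a @^-1: E i|)) /=.
apply: (@leq_trans (\sum_(j < q.+1) \sum_(a < q) #|E b0|)).
  apply: leq_sum => j _; apply: leq_sum => a _; rewrite card_preimset ?maxE //.
  by apply: can_inj (shift (- a)) _ => x; rewrite shiftD subrr shift0.
by rewrite !sum_nat_const !card_ord mulnCA mulnA [(_ * q.+1)%N]mulnC -!mulnA.
Qed.

End Rotation.

(** * Embedding words into the integers modulo a prime *)

Section Near.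
Variables (p K : nat).
Hypothesis p_prime : prime p.
Implicit Types (y : 'F_p) (r e : int).

(* [y / p] is within [e / K] of [r / K] modulo 1 *)
Definition near y r e := exists z : int, z%:~R = y /\ `|K%:Z * z - r * p%:Z| <= e * p%:Z.

Lemma p_gt0 : 0 < p%:Z.
Proof. exact: prime_gt0. Qed.

Lemma nearD y y' r r' e e' : near y r e -> near y' r' e' -> near (y + y') (r + r') (e + e').
Proof.
move=> [z [<- h]] [z' [<- h']]; exists (z + z'); rewrite rmorphD; split=> //.
rewrite mulrDr !mulrDl opprD addrACA; apply: le_trans (ler_normD _ _) _; exact: lerD.
Qed.

Lemma nearM (c : int) y r e : near y r e -> near (c%:~R * y) (c * r) (`|c| * e).
Proof.
move=> [z [<- h]]; exists (c * z); rewrite rmorphM; split=> //.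
by rewrite mulrCA -!mulrA -mulrBr normrM ler_wpM2l // mulrA.
Qed.

Lemma near_sum (I : finType) (P : pred I) (c : I -> int) (y : I -> 'F_p) (r e : I -> int) :
  (forall i, P i -> near (y i) (r i) (e i)) ->
  near (\sum_(i | P i) (c i)%:~R * y i) (\sum_(i | P i) c i * r i) (\sum_(i | P i) `|c i| * e i).
Proof.
move=> h; apply: (big_ind3 near) => [|x1 x2 x3 y1 y2 y3|i Pi].
- by exists 0; rewrite mulr0 !mul0r subrr normr0.
- exact: nearD.
- by apply: nearM; apply: h.
Qed.

Lemma near_le y r e e' : e <= e' -> near y r e -> near y r e'.
Proof.
move=> ee' [z [zy h]]; exists z; split=> //; apply: le_trans h _.
by rewrite ler_wpM2r // ltW // p_gt0.
Qed.

Lemma near_modulus y r e (m : int) : near y r e -> near y (r + m * K%:Z) e.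
Proof.
move=> [z [zy h]]; exists (z + m * p%:Z); split.
  by rewrite rmorphD rmorphM /= -[p%:Z]natz rmorph_nat pchar_Fp_0 // mulr0 addr0.
by apply: le_trans h; rewrite le_eqVlt; apply/orP; left; apply/eqP; congr `|_|; ring.
Qed.

Lemma near0 r e : near 0 r e -> exists m : int, `|K%:Z * m - r| <= e.
Proof.
move=> [z [z0 h]].
have /dvdzP[m zE] : (p%:Z %| z)%Z by rewrite (dvdz_pcharf (pchar_Fp p_prime)) z0.
exists m; rewrite -(ler_pM2r p_gt0); apply: le_trans h.
by rewrite zE mulrA -mulrBl normrM (gtr0_norm p_gt0).
Qed.

End Near.

Section Points.
Variables (p K D : nat).
Hypotheses (p_prime : prime p) (K_gt0 : (0 < K)%N).
Implicit Types (w : nat -> nat).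

Fixpoint prefix w j : nat := if j is i.+1 then (K * prefix w i + w i)%N else 0%N.

(** For [i = 0] this is the least [z] with [prefix w D * p <= K ^ D * z], so that [z / p] begins
    with the base [K] digits of [w]; [i] runs through the following integers in the same cell. *)
Definition point w i : nat := ((prefix w D * p + (K ^ D).-1) %/ K ^ D + i)%N.

Lemma point_bounds w i : (i < p %/ K ^ D)%N ->
  (prefix w D * p <= K ^ D * point w i < (prefix w D).+1 * p)%N.
Proof.
move=> ip; have N_gt0 : (0 < K ^ D)%N by rewrite expn_gt0 K_gt0.
rewrite /point; set N := (K ^ D)%N in ip N_gt0 *; set W := (prefix w D * p)%N.
have := leq_trunc_div p N; have := leq_trunc_div (W + N.-1) N.
have := ltn_ceil (W + N.-1) N_gt0; rewrite mulSn -/W.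
move: (p %/ N)%N ip ((W + N.-1) %/ N)%N => a ia b; nia.
Qed.

Lemma prefix_bounds w z j : (forall j, w j < K)%N -> (j <= D)%N ->
  (prefix w D * p <= K ^ D * z < (prefix w D).+1 * p)%N ->
  (prefix w j * p <= K ^ j * z < (prefix w j).+1 * p)%N.
Proof.
move=> wK jD h; rewrite -(subnK jD) in h; elim: (D - j)%N h => [//|i IHi].
rewrite addSn expnS /= => h; apply: IHi; have := wK (i + j)%N.
move: h; move: (K ^ _)%N (prefix _ _) (w _) => X P d h dK; nia.
Qed.

Lemma prefix_lt w j : (forall j, w j < K)%N -> (prefix w j < K ^ j)%N.
Proof.
move=> wK; elim: j => [|j IHj] //=; rewrite expnS; have := wK j; move: IHj.
move: (K ^ j)%N => X; nia.
Qed.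

Lemma point_lt w i : (forall j, w j < K)%N -> (i < p %/ K ^ D)%N -> (point w i < p)%N.
Proof.
move=> wK ip; have /andP[_ h] := point_bounds w ip; have := prefix_lt D wK.
move: h; move: (K ^ D)%N => X; nia.
Qed.

(** Multiplying by [K ^ j] modulo [p] drops the first [j] digits of [point w i / p]. *)
Lemma point_digit w i j : (forall j, w j < K)%N -> (i < p %/ K ^ D)%N -> (j < D)%N ->
  (w j * p <= K * ((K ^ j * point w i) %% p) < (w j).+1 * p)%N.
Proof.
move=> wK ip jD; have h := point_bounds w ip.
have /andP[h1 h2] := prefix_bounds wK (ltnW jD) h.
have := prefix_bounds wK jD h; rewrite expnS /=.
have -> : ((K ^ j * point w i) %% p = K ^ j * point w i - prefix w j * p)%N.
  by rewrite -{1}(subnK h1) addnC modnMDl modn_small; [ | move: h1 h2; rewrite mulSn; lia].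
move: h1 h2; move: (K ^ j)%N (point w i) => X z; nia.
Qed.

Lemma point_near w i j : (forall j, w j < K)%N -> (i < p %/ K ^ D)%N -> (j < D)%N ->
  near K ((K ^ j)%:R * (point w i)%:R : 'F_p) (w j)%:Z 1.
Proof.
move=> wK ip jD; exists ((K ^ j * point w i) %% p)%N%:Z; split.
  by rewrite -natrM -pmulrn Fp_nat_mod.
have := point_digit wK ip jD; move: ((_ * _) %% _)%N => z; nia.
Qed.

Lemma point_inj w w' i i' : (forall j, w j < K)%N -> (forall j, w' j < K)%N ->
  (i < p %/ K ^ D)%N -> (i' < p %/ K ^ D)%N ->
  (point w i)%:R = (point w' i')%:R :> 'F_p ->
  (forall j, (j < D)%N -> w j = w' j) /\ i = i'.
Proof.
move=> wK wK' ip ip' /(congr1 val) /=; rewrite !val_Fp_nat // !modn_small ?point_lt // => e.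
have ww' j : (j < D)%N -> w j = w' j.
  move=> jD; have := point_digit wK ip jD; have := point_digit wK' ip' jD; rewrite e.
  move: ((_ * _) %% _)%N => z; have := prime_gt0 p_prime; nia.
split=> //; move: e; rewrite /point; have -> : prefix w D = prefix w' D; last by move/addnI.
suff : forall j, (j <= D)%N -> prefix w j = prefix w' j by apply.
by elim=> [//|j IHj] jD /=; rewrite IHj ?ww' // ltnW.
Qed.

End Points.

Lemma near_shift p K y (r d e : int) : near (p:=p) K y (r + d) e -> near K y r (e + `|d|).
Proof.
move=> [z [zy h]]; exists z; split=> //.
rewrite (_ : _ - _ = (K%:Z * z - (r + d) * p%:Z) + d * p%:Z); last by ring.
apply: le_trans (ler_normD _ _) _; apply: le_trans (lerD h (lexx _)) _.
by rewrite mulrDl normrM [`|p%:Z|]ger0_norm.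
Qed.

(** Dividing all letters by [b] preserves distances and turns the shift by [b] into the shift by
    1. *)
Lemma rotation_free_set_unit Q (b : 'I_Q.+2) T n0 : b \is a GRing.unit ->
  exists n (E : {set {ffun 'I_n.+1 -> 'I_Q.+2}}),
  [/\ (n0 <= n)%N, (Q.+2 ^ n.+1 <= 14 * Q.+2 * Q.+3 * #|E|)%N &
      forall v w, v \in E -> w \in E -> (T < hdist (shift b v) w)%N].
Proof.
move=> b_unit; have [n [E [n0n cardE freeE]]] := rotation_free_set Q T n0.
pose scale (v : {ffun 'I_n.+1 -> 'I_Q.+2}) := [ffun i => v i / b].
have scale_inj : injective scale.
  move=> v w /ffunP e; apply/ffunP => i; have := e i; rewrite !ffunE; by apply: mulIr; rewrite unitrV.
exists n, (scale @^-1: E); split; rewrite ?card_preimset // => v w; rewrite !inE => vE wE.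
have := freeE _ _ vE wE; congr (_ < _)%N; apply: eq_card => i; rewrite !inE !ffunE.
by rewrite -[X in _ / _ + X](divrr b_unit) -mulrDl (inj_eq (mulIr _)) ?unitrV.
Qed.

(** Bernoulli's inequality [(1 - Y / X) ^ n >= 1 - n Y / X], cleared of denominators. *)
Lemma bernoulli_half X Y n : (2 * (n * Y) <= X)%N -> (X ^ n <= 2 * (X - Y) ^ n)%N.
Proof.
case: n => [|n] // nYX; set m := n.+1 in nYX *.
have YX : (Y <= X)%N by apply: leq_trans nYX; rewrite /m; nia.
suff : (X ^ m * X <= X * (X - Y) ^ m + m * Y * X ^ m)%N.
  case: (posnP X) => [-> | X_gt0]; first by rewrite exp0n.
  move: (X ^ m)%N ((X - Y) ^ m)%N => A A'; nia.
elim: m {nYX} => [|m IHm]; first by rewrite !expn0; lia.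
rewrite !expnS; move: IHm (leq_subr Y X) (subnK YX).
move: (X - Y)%N => W; move: (X ^ m)%N (W ^ m)%N => A A' IHm WX XE.
have h : (W * (A * X) <= W * (X * A' + m * Y * A))%N by rewrite leq_mul2l IHm orbT.
apply: (@leq_trans (W * (A * X) + Y * (A * X))); first by rewrite -mulnDl XE; lia.
apply: leq_trans (leq_add h (leqnn _)) _.
have : (m * Y * A * W <= m * Y * A * X)%N by rewrite leq_mul2l WX orbT.
lia.
Qed.

Lemma mul_lt_eq0 (d : nat) (z : int) : `|d%:Z * z| < d%:Z -> z = 0.
Proof.
case: d => [|d]; first by rewrite mul0r normr0 ltxx.
rewrite normrM [`|d.+1%:Z|]ger0_norm // -[ltRHS]mulr1 ltr_pM2l // => h; lia.
Qed.

(** The error budget of one coordinate: two entries in [A1], the entries in [A2], and the offsets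
    [r1], [r2] inside the cells. *)
Lemma offset_bound (r1 r2 d b : nat) : (r1 < d - 2 * (2 * b + 2))%N -> (r2 < d - 2 * (2 * b + 2))%N ->
  1 + `|-1| * 1 + b%:Z * 2 + `|r1%:Z - r2%:Z| < d%:Z.
Proof. lia. Qed.

(** * Dense solution-free sets of large chromatic number *)

Section Construction.
Variables (k : nat) (c : 'I_k -> int) (a : int).
Variables (B : nat) (sigma : int).
Hypotheses (BE : B = (\sum_l `|c l|)%N) (sigmaE : sigma = \sum_l c l).
Hypothesis c_neq0 : forall l, c l != 0.
Hypothesis no_zero_sum : forall I : {set 'I_k}, (2 < #|I|)%N -> \sum_(l in I) c l != 0.
Hypotheses (B_gt0 : (0 < B)%N) (a_neq0 : a != 0) (a_le : (`|a| <= B)%N).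
Hypothesis a_pair : forall i j, i != j -> c i + c j = 0 -> `|c i|%N = `|a|%N.

Variables (Q t n L p : nat) (E : {set {ffun 'I_n.+1 -> 'I_Q.+2}}).
Local Notation q := Q.+2.
Local Notation Z := 'I_q.
Variables (K' K theta omega gap : nat).
(** Here [K = 2 B theta] separates the multiples [s theta] with [|s| <= B] modulo [K]. The width
    [omega] makes [B (omega + 1 + 2 |a|) < theta], and [gap] is the error [2 + 2 B] of a
    coordinate. *)
Hypotheses (K'E : K' = (2 * B ^ 2 * L)%N) (KK' : K = (q * K')%N) (thetaE : theta = (B * q * L)%N).
Hypotheses (omegaE : omega = (q * L - 2 - 2 * B)%N) (gapE : gap = (2 * B + 2)%N).
Hypothesis q_ndiv : ~~ (q%:Z %| sigma)%Z.
Hypothesis kt_lt : (k * t < n.+1)%N.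
Hypothesis E_free : forall v w, v \in E -> w \in E -> (k * t < hdist (shift (sigma%:~R : Z) v) w)%N.
Hypothesis L_ge : (4 * gap * n.+1 + 2 <= L)%N.
Hypothesis p_prime : prime p.
Hypothesis p_gt : (K ^ n.+2 + B < p)%N.

(* [K'] is the width of the cell of a letter of [Z/q].  Inside it, words of [A1] keep at distance
   [gap] from the boundary.  The last digit lies in [[theta, theta + omega]] for [A1] and is 0 for
   the points whose differences make up [A2]. *)
Definition digits (h : 'I_n.+1 -> nat) (l j : nat) : nat := if insub j is Some i then h i else l.

Lemma digits_ord h l (i : 'I_n.+1) : digits h l i = h i.
Proof. by rewrite /digits valK. Qed.

Lemma digits_last h l : digits h l n.+1 = l.
Proof. by rewrite /digits insubF // ltnn. Qed.

Local Notation pt := (point p K n.+2).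
Local Notation m := (p %/ K ^ n.+2)%N.

Definition A1word (v : {ffun 'I_n.+1 -> Z}) (rho : {ffun 'I_n.+1 -> 'I_(K' - 2 * gap)}) (u : 'I_omega.+1) :=
  digits (fun i => v i * K' + gap + rho i)%N (theta + u).

Definition A2word (v : {ffun 'I_n.+1 -> Z}) := digits (fun i => v i * K')%N 0.

Lemma L_gt1 : (1 < L)%N. Proof. by apply: leq_trans L_ge; lia. Qed.

Lemma qL_ge : (4 * B + 4 <= q * L)%N.
Proof.
apply: (@leq_trans L); last by rewrite leq_pmull.
by apply: leq_trans L_ge; rewrite gapE mulnS; move: (_ * n)%N => Y; clear; lia.
Qed.

Lemma K'_gt : (2 * B < K')%N.
Proof. have := L_gt1; rewrite K'E; move: B_gt0; nia. Qed.

Lemma K'_gap : (4 * gap * n.+1 <= K')%N.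
Proof. by apply: (@leq_trans L); [move: L_ge; lia | rewrite K'E; move: B_gt0; nia]. Qed.

Lemma K_gt0 : (0 < K)%N.
Proof. by have := K'_gt; rewrite KK'; nia. Qed.

Lemma KE : K = (2 * B * theta)%N.
Proof. by rewrite KK' K'E thetaE; ring. Qed.

Lemma A1word_lt v rho u j : (A1word v rho u j < K)%N.
Proof.
rewrite /A1word /digits; case: insubP => [i _ _|_].
  have := ltn_ord (v i); have := ltn_ord (rho i); rewrite KK'.
  move: (v i : nat) (rho i : nat) => x y; nia.
have : (u <= omega)%N by rewrite -ltnS.
move: (u : nat) => {}u; rewrite KE omegaE => u_le.
have : (q * L <= theta)%N by rewrite thetaE; move: B_gt0; nia.
have : (0 < q * L)%N by rewrite muln_gt0 (ltn_trans _ L_gt1).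
have : (theta <= B * theta)%N by rewrite leq_pmull.
by rewrite -mulnA; move: (q * L)%N (B * theta)%N u_le => X Y; lia.
Qed.

Lemma A2word_lt v j : (A2word v j < K)%N.
Proof.
rewrite /A2word /digits; case: insubP => [i _ _|_]; last exact: K_gt0.
by rewrite KK' ltn_mul2r ltn_ord andbT; have := K'_gt; lia.
Qed.

Definition A1scaled : {set 'F_p} :=
  [set (pt (A1word x.1.1.1 x.1.1.2 x.1.2) (x.2 : 'I_m))%:R | x in
    setX (setX (setX E [set: {ffun 'I_n.+1 -> 'I_(K' - 2 * gap)}]) [set: 'I_omega.+1]) [set: 'I_m]].

Definition A1 : {set 'F_p} := (fun x => a%:~R * x) @^-1: A1scaled.

(** The differences along the edges of the rotation graph on words, which is thereby mapped into the
    Cayley graph. *)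
Definition A2 : {set 'F_p} :=
  [set y | [exists v, exists w, (hdist (shift 1%R v) w <= t)%N &&
     (y == (pt (A2word w) 0)%:R - (pt (A2word v) 0)%:R)]].

Lemma aF_neq0 : a%:~R != 0 :> 'F_p.
Proof.
rewrite -(dvdz_pcharf (pchar_Fp p_prime)) dvdzE absz_nat.
apply/negP => /dvdn_leq; rewrite absz_gt0 => /(_ a_neq0); move: a_le p_gt; lia.
Qed.

Lemma m_gt0 : (0 < m)%N.
Proof. by rewrite divn_gt0 ?expn_gt0 ?K_gt0 //; move: p_gt; lia. Qed.

Lemma card_A1 : #|A1| = (#|E| * (K' - 2 * gap) ^ n.+1 * omega.+1 * m)%N.
Proof.
rewrite /A1 card_preimset; last exact: mulfI aF_neq0.
rewrite card_in_imset; first by rewrite !cardsX !cardsT !card_ord card_ffun !card_ord.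
move=> [[[v rho] u] i] [[[v' rho'] u'] i'] _ _ /= e.
have [digE iE] := point_inj p_prime K_gt0 (A1word_lt v rho u) (A1word_lt v' rho' u') (ltn_ord i) (ltn_ord i') e.
have uE : u = u'.
  by apply: val_inj; have := digE n.+1 (ltnSn _); rewrite /A1word !digits_last => /addnI.
have vE (j : 'I_n.+1) : v j = v' j /\ rho j = rho' j.
  have := digE j (ltn_trans (ltn_ord j) (ltnSn _)); rewrite /A1word !digits_ord => e0.
  have e' : (v j * K' + (gap + rho j) = v' j * K' + (gap + rho' j))%N by rewrite !addnA.
  have lt1 : (gap + rho j < K')%N by rewrite -ltn_subRL; apply: leq_trans (ltn_ord _) _; rewrite leq_sub2l ?leq_pmull.
  have lt2 : (gap + rho' j < K')%N by rewrite -ltn_subRL; apply: leq_trans (ltn_ord _) _; rewrite leq_sub2l ?leq_pmull.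
  have ev : v j = v' j :> nat.
    have K'_gt0 : (0 < K')%N := leq_ltn_trans (leq0n _) K'_gt.
    by have := congr1 (divn^~ K') e'; rewrite /= !divnMDl // (divn_small lt1) (divn_small lt2) !addn0.
  split; apply: val_inj => //=; move: e'; rewrite ev => /addnI/addnI //.
congr (_, _, _, _) => //; last exact: val_inj.
- by apply/ffunP => j; case: (vE j).
- by apply/ffunP => j; case: (vE j).
Qed.

Lemma A1_near x : x \in A1 -> exists v (rho : 'I_n.+1 -> nat),
  [/\ v \in E, forall i, (rho i < K' - 2 * gap)%N,
      forall i : 'I_n.+1, near K ((K ^ i)%:R * (a%:~R * x)) (v i * K' + gap + rho i)%N%:Z 1 &
      near K ((K ^ n.+1)%:R * (a%:~R * x)) theta%:Z omega.+1%:Z].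
Proof.
rewrite inE => /imsetP[[[[v rho] u] i] /=]; rewrite !inE !andbT => vE ->.
exists v, (fun j => rho j : nat); split=> // [j|].
  have := point_near p_prime K_gt0 (A1word_lt v rho u) (ltn_ord i) (ltn_trans (ltn_ord j) (ltnSn _)).
  by rewrite {2}/A1word digits_ord.
have := point_near p_prime K_gt0 (A1word_lt v rho u) (ltn_ord i) (ltnSn n.+1).
rewrite {2}/A1word digits_last PoszD => /near_shift h; apply: near_le h.
have := ltn_ord u; lia.
Qed.

Lemma A2_near y : y \in A2 -> exists2 bad : {set 'I_n.+1}, (#|bad| <= t)%N &
  (forall i, i \notin bad -> near K ((K ^ i)%:R * y) K'%:Z 2) /\ near K ((K ^ n.+1)%:R * y) 0 2.
Proof.
rewrite inE => /existsP[v /existsP[w /andP[vw /eqP->]]].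
have nearW j : (j < n.+2)%N ->
    near K ((K ^ j)%:R * ((pt (A2word w) 0)%:R - (pt (A2word v) 0)%:R) : 'F_p)
           ((A2word w j)%:Z - (A2word v j)%:Z) 2.
  move=> jn; rewrite mulrBr.
  have h1 := point_near p_prime K_gt0 (A2word_lt w) m_gt0 jn.
  have := nearM (-1) (point_near p_prime K_gt0 (A2word_lt v) m_gt0 jn).
  by rewrite mulrN1z mulN1r mulN1r; exact: nearD.
exists [set i | shift 1 v i != w i] => //; split => [i|]; last first.
  by have := nearW n.+1 (ltnSn _); rewrite /A2word !digits_last subrr.
rewrite inE negbK ffunE => /eqP vwi.
have := nearW i (ltn_trans (ltn_ord i) (ltnSn _)); rewrite /A2word !digits_ord -vwi.
(* When the letter wraps around, the digits differ by [K' - K], and [near_modulus] restores the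
   missing [K]. *)
have [/eqP vi | vi] := boolP (v i == -1).
  rewrite vi addNr mul0n sub0r => h.
  have := near_modulus p_prime 1 h; congr (near _ _ _ _).
  rewrite val_Zp_opp1.
  rewrite KK'; nia.
rewrite val_Zp_succ (negPf vi).
by congr (near _ _ _ _); rewrite mulSn PoszD addrK.
Qed.

Lemma near_solution (y : 'I_k -> 'F_p) (r : 'I_k -> int) (j : nat) (e : int) :
  (forall l, near K ((K ^ j)%:R * y l) (r l) e) -> \sum_l (c l)%:~R * y l = 0 ->
  exists m : int, `|K%:Z * m - \sum_l c l * r l| <= B%:Z * e.
Proof.
move=> near_y sum0; have := near_sum (P := xpredT) c (fun l _ => near_y l).
rewrite -mulr_suml.
have -> : \sum_l (c l)%:~R * ((K ^ j)%:R * y l) = 0.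
  by under eq_bigr => l _ do rewrite mulrCA; rewrite -mulr_sumr sum0 mulr0.
move/(near0 p_prime) => [m' hm']; exists m'; apply: le_trans hm' _.
by rewrite BE -[(\sum_l _)%N%:Z]natz natr_sum; under [in leRHS]eq_bigr => l _ do rewrite natz abszE.
Qed.

(** In the last coordinate the total error is below [theta], so [theta] times the sum over [S] is
    closer than [theta] to a multiple of [K = 2 B theta]. As that sum is at most [B] in absolute
    value, it is 0. *)
Lemma sum_A1_eq0 (x : 'I_k -> 'F_p) (S : {set 'I_k}) :
  (forall l, l \in S -> x l \in A1) -> (forall l, l \notin S -> x l \in A2) ->
  \sum_l (c l)%:~R * x l = 0 -> \sum_(l in S) c l = 0.
Proof.
move=> xS xnS sum0; pose e : int := (omega.+1 + 2 * `|a|)%N.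
pose r l : int := if l \in S then theta%:Z else 0.
have near_y l : near K ((K ^ n.+1)%:R * (a%:~R * x l)) (r l) e.
  rewrite /r; case: ifPn => [/xS/A1_near[v [rho [_ _ _ h]]] | /xnS/A2_near[bad _ [_ h]]].
    by apply: near_le h; rewrite /e lez_nat leq_addr.
  rewrite mulrCA -[X in near _ _ X _](mulr0 a); apply: near_le (nearM a h).
  by rewrite /e -abszE; lia.
have [|m' hm'] := near_solution near_y.
  by under eq_bigr => l _ do rewrite mulrCA; rewrite -mulr_sumr sum0 mulr0.
set s := \sum_(l in S) c l.
have sumE : \sum_l c l * r l = s * theta%:Z.
  rewrite /s mulr_suml [RHS]big_mkcond; apply: eq_bigr => l _; rewrite /r.
  by case: ifP => // _; rewrite mulr0.
have s_le : `|s| <= B%:Z.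
  rewrite BE -[(\sum_l _)%N%:Z]natz natr_sum; apply: le_trans (ler_norm_sum _ _ _) _.
  rewrite [leLHS]big_mkcond; apply: ler_sum => l _; rewrite natz abszE; case: ifP => // _.
have theta_gt : B%:Z * e < theta%:Z.
  have := L_gt1 => L1; rewrite /e -PoszM ltz_nat thetaE -mulnA ltn_mul2l B_gt0 /= omegaE.
  by move: a_le qL_ge; move: (q * L)%N (`|a|%N) => X Y h1 h2; clear -h1 h2; lia.
have h := le_lt_trans hm' theta_gt.
move: h; rewrite sumE KE !PoszM -[X in `|X|](_ : theta%:Z * (2 * B%:Z * m' - s) = _); last by ring.
move/mul_lt_eq0/eqP; rewrite subr_eq0 => /eqP.
have [-> | m'0] := eqVneq m' 0; first by rewrite mulr0.
move=> sB; move: s_le; rewrite -sB; have : (0 < `|m'|)%R by rewrite normr_gt0.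
rewrite normrM (@ger0_norm _ (2 * B%:Z)) //; move: `|m'| => M M_gt0 M_le; exfalso.
have : 2 * B%:Z <= 2 * B%:Z * M by rewrite ler_peMr.
by move: M_le B_gt0; move: (_ * M) => X h1 h2; clear -h1 h2; lia.
Qed.

(** The set [S] of entries in [A1] has zero coefficient sum, hence zero or two elements. Outside the
    few coordinates in [U] the other entries are near [K']. If [S] is empty, one such coordinate
    gives [q | sigma]; if [S] is a pair, all of them give [w = v + sigma] there, against
    [E_free]. *)
Lemma A1_A2_solution_free (x : 'I_k -> 'F_p) :
  (forall l, x l \in A1 :|: A2) -> \sum_l (c l)%:~R * x l <> 0.
Proof.
move=> xA sum0; pose S := [set l | x l \in A1].
have xS l : l \in S -> x l \in A1 by rewrite inE.
have xnS l : l \notin S -> x l \in A2 by have := xA l; rewrite !inE; case: (_ \in _).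
have S0 := sum_A1_eq0 xS xnS sum0.
have S_le2 : (#|S| <= 2)%N by rewrite leqNgt; apply/negP => /no_zero_sum; rewrite S0 eqxx.
have /fin_all_exists[bad hbad] l : exists bad : {set 'I_n.+1}, (#|bad| <= t)%N /\
    (l \notin S -> forall i, i \notin bad -> near K ((K ^ i)%:R * x l) K'%:Z 2).
  have [lS|/xnS/A2_near[bad ? [? _]]] := boolP (l \in S); last by exists bad.
  by exists set0; rewrite cards0.
pose U := \bigcup_l bad l.
have U_le : (#|U| <= k * t)%N.
  apply: (@leq_trans (\sum_l #|bad l|)); first by apply: card_le_cover => i /bigcupP[l _]; exists l.
  apply: (@leq_trans (\sum_(l < k) t)); first by apply: leq_sum => l _; case: (hbad l).
  by rewrite sum_nat_const card_ord.
have near_U i l : i \notin U -> l \notin S -> near K ((K ^ i)%:R * x l) K'%:Z 2.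
  move=> iU lS; have [_ h] := hbad l; apply: h => //.
  by apply: contra iU => il; apply/bigcupP; exists l.
have K'_lt := K'_gt.
have S_cases : #|S| = 0%N \/ #|S| = 1%N \/ #|S| = 2%N by lia.
case: S_cases => [/eqP|[/eqP|/eqP]].
- rewrite cards_eq0 => /eqP S_empty.
  have [i iU] : exists i, i \notin U.
    apply/existsP; rewrite -negb_forall; apply: contraTN (leq_ltn_trans U_le kt_lt) => /forallP UT.
    by rewrite -leqNgt -[X in (X <= _)%N](card_ord n.+1) subset_leq_card //; apply/subsetP => i _.
  have iS l : l \notin S by rewrite S_empty inE.
  have [m' hm'] := near_solution (fun l => near_U i l iU (iS l)) sum0.
  move: q_ndiv; apply/negP/negPn; apply/dvdzP; exists m'; move: hm'.
  rewrite -mulr_suml -sigmaE KK' PoszM -[X in `|X|](_ : K'%:Z * (q%:Z * m' - sigma) = _); last by ring.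
  move=> hm'; have /mul_lt_eq0/eqP : `|K'%:Z * (q%:Z * m' - sigma)| < K'%:Z.
    by apply: le_lt_trans hm' _; rewrite -PoszM ltz_nat mulnC.
  by rewrite subr_eq0 mulrC => /eqP.
- by move=> /cards1P[l Sl]; move: S0; rewrite Sl big_set1 => /eqP; rewrite (negPf (c_neq0 l)).
move=> /cards2P[j1 [j2 [j12 SE]]].
have cj : c j1 + c j2 = 0 by move: S0; rewrite SE big_setU1 ?inE //= big_set1.
have [i1 [i2 [i12 {}SE ci1 ci2]]] : exists i1 i2, [/\ i1 != i2, S = [set i1; i2], c i1 = a & c i2 = - a].
  have := a_pair j12 cj => abs_c.
  have [c1|c1] : c j1 = a \/ c j1 = - a by lia.
    by exists j1, j2; split=> //; lia.
  by exists j2, j1; split; rewrite 1?eq_sym 1?setUC //; lia.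
have [i1S i2S] : i1 \in S /\ i2 \in S by rewrite SE !inE !eqxx orbT.
have [v [rho [vE rho_lt near_v _]]] := A1_near (xS i1 i1S).
have [w [rho' [wE rho'_lt near_w _]]] := A1_near (xS i2 i2S).
have := E_free vE wE; rewrite ltnNge => /negP; apply.
apply: leq_trans U_le; apply/subset_leq_card/subsetP => i; rewrite inE; apply: contraNT => iU.
rewrite ffunE eq_sym; apply/eqP.
pose r l : int := if l == i1 then 0 else if l == i2 then 0 else K'%:Z.
have sumS (F : 'I_k -> int) : \sum_l F l = F i1 + F i2 + \sum_(l | l \notin S) F l.
  by rewrite (bigID (mem S)) /= {1}SE big_setU1 ?inE //= big_set1.
have sumSF (F : 'I_k -> 'F_p) : \sum_l F l = F i1 + F i2 + \sum_(l | l \notin S) F l.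
  by rewrite (bigID (mem S)) /= {1}SE big_setU1 ?inE //= big_set1.
have near_out := near_sum (P := fun l => l \notin S) c (fun l lS => near_U i l iU lS).
have := nearD (nearD (near_v i) (nearM (-1) (near_w i))) near_out.
(* The coefficients [a] and [- a] turn the two entries in [A1] into their multiples by [a], whose
   coordinates [A1] prescribes. *)
have -> : (K ^ i)%:R * (a%:~R * x i1) + (-1)%:~R * ((K ^ i)%:R * (a%:~R * x i2)) +
    \sum_(l | l \notin S) (c l)%:~R * ((K ^ i)%:R * x l) = 0.
  transitivity ((K ^ i)%:R * \sum_l (c l)%:~R * x l); last by rewrite sum0 mulr0.
  rewrite sumSF ci1 ci2 !mulrDr mulr_sumr; congr (_ + _ + _).
    by rewrite mulrN1z mulN1r rmorphN mulNr mulrN.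
  by apply: eq_bigr => l _; rewrite mulrCA.
move/(near0 p_prime) => [m' hm'].
have c_out : \sum_(l | l \notin S) c l = sigma by rewrite sigmaE sumS ci1 ci2 subrr add0r.
have abs_out : \sum_(l | l \notin S) `|c l| * 2 <= B%:Z * 2.
  rewrite -mulr_suml ler_pM2r // BE -[(\sum_l _)%N%:Z]natz natr_sum [leLHS]big_mkcond.
  by apply: ler_sum => l _; rewrite natz abszE; case: ifP.
move: hm'; rewrite -mulr_suml c_out => hm'.
have {abs_out}hm' := le_trans hm' (lerD (lexx _) abs_out).
(* All errors together stay below [K'], so the estimate becomes an equation, to be read modulo
   [q]. *)
have : q%:Z * m' = (v i)%:Z - (w i)%:Z + sigma.
  apply/eqP; rewrite -subr_eq0; apply/eqP; apply: (@mul_lt_eq0 K').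
  have -> : K'%:Z * (q%:Z * m' - ((v i)%:Z - (w i)%:Z + sigma)) =
    (K%:Z * m' - ((v i * K' + gap + rho i)%N%:Z + -1 * (w i * K' + gap + rho' i)%N%:Z + sigma * K'%:Z)) +
    ((rho i)%:Z - (rho' i)%:Z) by rewrite KK' !PoszD !PoszM; ring.
  apply: le_lt_trans (ler_normD _ _) _; apply: le_lt_trans (lerD hm' (lexx _)) _.
  by apply: offset_bound; rewrite -gapE.
move/(congr1 (fun z : int => z%:~R : Z)).
rewrite rmorphM rmorphD rmorphB /= -!pmulrn (@pchar_Zp q isT : q%:R = 0 :> Z) mul0r !natr_Zp => /esym/eqP.
by rewrite addrAC subr_eq0 => /eqP.
Qed.

(** A colouring pulls back to words. The two words from [word_chromatic] give distinct points,
    because [v] and its shift differ in all [n + 1 > t] coordinates. *)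
Lemma A2_uncolorable (C : nat) (A : {set 'F_p}) : A2 \subset A -> prime q ->
  (4 * q ^ 2 * C <= t)%N -> (t < n.+1)%N -> ~ cayley_colorable A C.
Proof.
move=> A2A q_prime Ct tn [f f_proper].
have [v [w [vw fvw]]] := word_chromatic (fun v => f (pt (A2word v) 0)%:R) q_prime.
have /eqP := fvw; apply/negP; apply: f_proper.
  apply: contraTneq tn => e; rewrite -leqNgt; apply: leq_trans Ct; apply: leq_trans vw.
  have [digE _] := point_inj p_prime K_gt0 (A2word_lt v) (A2word_lt w) m_gt0 m_gt0 e.
  rewrite -[X in (X <= _)%N](card_ord n.+1) subset_leq_card //; apply/subsetP => i _.
  have := digE i (ltn_trans (ltn_ord i) (ltnSn _)); rewrite /A2word !digits_ord inE ffunE => /eqP.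
  rewrite eqn_mul2r (gtn_eqF (leq_ltn_trans (leq0n _) K'_gt)) /= => /eqP/val_inj->.
  by rewrite -subr_eq0 addrAC subrr add0r oner_eq0.
apply: (subsetP A2A); rewrite inE; apply/existsP; exists v; apply/existsP; exists w.
by rewrite eqxx andbT; apply: leq_trans vw Ct.
Qed.

(** The losses are [14 q (q + 1)] from [E], 2 from the gaps, [4 B ^ 2] from the last digit and 2
    from rounding [p / K ^ (n + 2)]. *)
Lemma A1_dense : (q ^ n.+1 <= 14 * q * q.+1 * #|E|)%N ->
  (p <= 224 * q * q.+1 * B ^ 2 * #|A1|)%N.
Proof.
move=> E_dense; rewrite card_A1; set e := #|E| in E_dense *.
have K_pow : (K ^ n.+2 = q ^ n.+1 * K' ^ n.+1 * K)%N by rewrite expnSr {1}KK' expnMn.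
have K'_pow : (K' ^ n.+1 <= 2 * (K' - 2 * gap) ^ n.+1)%N.
  by apply: bernoulli_half; apply: leq_trans K'_gap; lia.
have K_le : (K <= 4 * B ^ 2 * omega.+1)%N.
  have -> : K = (2 * B ^ 2 * (q * L))%N by rewrite KK' K'E; ring.
  rewrite (_ : 4 * B ^ 2 * omega.+1 = 2 * B ^ 2 * (2 * omega.+1))%N; last by ring.
  rewrite leq_mul2l; apply/orP; right; rewrite omegaE.
  by move: (q * L)%N qL_ge => X h; clear -h; lia.
have p_le : (p <= 2 * m * K ^ n.+2)%N.
  have := ltn_ceil p (_ : 0 < K ^ n.+2)%N; rewrite expn_gt0 K_gt0 => /(_ isT).
  rewrite mulSn => /ltnW h; apply: leq_trans h _; rewrite mul2n -addnn mulnDl leq_add2r.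
  by rewrite leq_pmull ?m_gt0.
move: m p_le => mm p_le; apply: leq_trans p_le _; rewrite K_pow.
apply: (@leq_trans (2 * mm * (14 * q * q.+1 * e * (2 * (K' - 2 * gap) ^ n.+1) * (4 * B ^ 2 * omega.+1)))).
  by apply: leq_mul => //; do 2![apply: leq_mul => //].
by rewrite leq_eqVlt; apply/orP; left; apply/eqP; ring.
Qed.

End Construction.

Lemma intr_Zp_unit Q (s : int) : prime Q.+2 -> ~~ (Q.+2%:Z %| s)%Z -> (s%:~R : 'I_Q.+2) \is a GRing.unit.
Proof.
move=> q_prime; rewrite dvdzE absz_nat => nd.
have unit_nat : (`|s|%N%:R : 'I_Q.+2) \is a GRing.unit.
  by have := @unitZpE Q.+2 `|s| isT; rewrite /= => ->; rewrite prime_coprime.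
by case: (intP s) unit_nat => [|m|m]; rewrite ?abszN ?absz_nat // rmorphN unitrN.
Qed.

Lemma high_chromatic_dense (k : nat) (c : 'I_k -> int) : (2 < k)%N -> (forall l, c l != 0) ->
  (forall I : {set 'I_k}, (2 < #|I|)%N -> \sum_(l in I) c l != 0) ->
  exists2 M : nat, (0 < M)%N & forall C : nat, exists2 p, prime p &
    exists A : {set 'F_p}, [/\ solution_free c A, (p <= M * #|A|)%N & ~ cayley_colorable A C].
Proof.
move=> k_gt2 c_neq0 no_zero_sum.
pose B := (\sum_l `|c l|)%N; pose sigma := \sum_l c l.
have le_B l : (`|c l| <= B)%N by rewrite /B (bigD1 l) //= leq_addr.
have B_gt0 : (0 < B)%N.
  have i0 : 'I_k := Ordinal (ltn_trans (isT : 0 < 2)%N k_gt2).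
  by apply: leq_trans (le_B i0); rewrite absz_gt0.
have sigma_neq0 : sigma != 0.
  have := no_zero_sum setT; rewrite cardsT card_ord => /(_ k_gt2).
  by rewrite (eq_bigl xpredT) // => i; rewrite inE.
have [a [a_neq0 a_le a_pair]] : exists a : int, [/\ a != 0, (`|a| <= B)%N &
    forall i j, i != j -> c i + c j = 0 -> `|c i|%N = `|a|%N].
  case: (pickP (fun ij : 'I_k * 'I_k => (ij.1 != ij.2) && (c ij.1 + c ij.2 == 0))); last first.
    move=> no_pair; exists 1; split=> // i j ij cij.
    by have := no_pair (i, j); rewrite /= ij cij eqxx.
  move=> [i1 j1] /= /andP[ij1 /eqP cij1]; exists (c i1); split=> // i j ij cij.
  (* Two opposite pairs of different absolute values would make four distinct indices with zero
     sum. *)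
  apply/eqP/negPn/negP => abs_neq.
  have ni1 : i1 != i by apply: contraNneq abs_neq => ->.
  have nj1 : i1 != j by apply: contraNneq abs_neq => e; rewrite e; lia.
  have ni2 : j1 != i by apply: contraNneq abs_neq => e; move: cij1; rewrite e; lia.
  have nj2 : j1 != j by apply: contraNneq abs_neq => e; move: cij1; rewrite e; lia.
  have sumI (F : 'I_k -> int) : \sum_(l in i1 |: (j1 |: [set i; j])) F l = F i1 + (F j1 + (F i + F j)).
    rewrite !big_setU1 ?big_set1 //= !inE ?negb_or ?ij ?ij1 ?ni1 ?nj1 ?ni2 ?nj2 //.
  have := no_zero_sum (i1 |: (j1 |: [set i; j])).
  rewrite sumI cij addr0 cij1 eqxx => no4; have /no4// : (2 < #|i1 |: (j1 |: [set i; j])|)%N.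
  by rewrite !cardsU1 cards1 !inE ?negb_or ij ij1 ni1 nj1 ni2 nj2.
(* The prime [q], and with it the density bound, depends on [c] alone, whereas [n] and [p] are
   chosen after [C]. *)
have [q q_gt q_prime] := prime_above `|sigma|.
case: q q_gt q_prime => [|[|Q]] // q_gt q_prime.
have q_ndiv : ~~ (Q.+2%:Z %| sigma)%Z.
  rewrite dvdzE absz_nat; apply/negP => /dvdn_leq; rewrite absz_gt0 sigma_neq0 => /(_ isT).
  by rewrite leqNgt q_gt.
exists (224 * Q.+2 * Q.+3 * B ^ 2)%N; first by rewrite !muln_gt0 ?expn_gt0 !B_gt0.
move=> C; pose t := (4 * Q.+2 ^ 2 * C)%N.
have [n [E [n_ge E_dense E_free]]] :=
  rotation_free_set_unit (k * t) (k * t) (intr_Zp_unit q_prime q_ndiv).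
pose L := (4 * (2 * B + 2) * n.+1 + 2)%N; pose K' := (2 * B ^ 2 * L)%N; pose K := (Q.+2 * K')%N.
have [p p_gt p_prime] := prime_above (K ^ n.+2 + B).
have kt_lt : (k * t < n.+1)%N by rewrite ltnS.
have L_ge := leqnn L.
pose X1 := A1 a p E K' K (B * Q.+2 * L) (Q.+2 * L - 2 - 2 * B) (2 * B + 2).
pose X2 := @A2 Q t n p K' K.
exists p => //; exists (X1 :|: X2); split.
- move=> [x [_ xA]]; exact: (A1_A2_solution_free (erefl B) (erefl sigma) c_neq0 no_zero_sum
    B_gt0 a_neq0 a_le a_pair (erefl K') (erefl K) (erefl _) (erefl _) (erefl _)
    q_ndiv kt_lt E_free L_ge p_prime p_gt xA).
- apply: (@leq_trans (224 * Q.+2 * Q.+3 * B ^ 2 * #|X1|)%N); last by rewrite leq_mul2l subset_leq_card ?subsetUl ?orbT.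
  exact: (A1_dense (erefl B) (erefl sigma) B_gt0 a_neq0 a_le (erefl K') (erefl K) (erefl _) (erefl _) (erefl _)
    q_ndiv kt_lt L_ge p_prime p_gt E_dense).
apply: (A2_uncolorable (erefl B) (erefl sigma) B_gt0 a_neq0 a_le (erefl K') (erefl K) (erefl _) (erefl _) (erefl _)
  q_ndiv kt_lt L_ge p_prime p_gt _ q_prime (leqnn _)).
  exact: subsetUr.
by apply: leq_ltn_trans kt_lt; rewrite leq_pmull // (ltn_trans _ k_gt2).
Qed.

(** * Almost periods of convolutions *)

Lemma sum_translate (R : nmodType) (F : finZmodType) (t : F) (h : F -> R) :
  \sum_x h (x + t) = \sum_x h x.
Proof. by rewrite [RHS](reindex_inj (addIr t)). Qed.

Lemma sum_opp (R : nmodType) (F : finZmodType) (h : F -> R) : \sum_x h (- x) = \sum_x h x.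
Proof. by rewrite [RHS](reindex_inj oppr_inj). Qed.

Section Oscillation.
Variables (R : realFieldType) (F : finZmodType).
Implicit Types (K g : F -> R) (s t : F).

Definition osc K t : R := \sum_x `|K (x + t) - K x|.

Lemma osc_ge0 K t : 0 <= osc K t.
Proof. exact: sumr_ge0. Qed.

Definition avg (B : {set F}) g x : R := (\sum_(b in B) g (x + b)) / #|B|%:R.

(** Almost periods are recorded as differences of a dense set, a form that survives intersections
    and serves both smoothing and colouring. *)
Definition dense_diff (d : R) (P : F -> bool) :=
  exists T : {set F}, d * #|F|%:R <= #|T|%:R /\ forall t t', t \in T -> t' \in T -> P (t - t').

Lemma avg_itv B g x : (forall y, 0 <= g y <= 1) -> 0 <= avg B g x <= 1.
Proof.
move=> g01; have [B0|B_gt0] := posnP #|B|.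
  by rewrite /avg B0 invr0 mulr0 lexx ler01.
apply/andP; split.
  by apply: divr_ge0; rewrite ?ler0n //; apply: sumr_ge0 => b _; case/andP: (g01 (x + b)).
rewrite ler_pdivrMr ?ltr0n // mul1r -sum1_card natr_sum; apply: ler_sum => b _.
by case/andP: (g01 (x + b)).
Qed.

Lemma card_F_gt0 : 0 < #|F|%:R :> R.
Proof. by rewrite ltr0n; apply/card_gt0P; exists 0. Qed.

End Oscillation.

(** For independent samples of mean zero the cross terms vanish and only the variances remain. *)
Lemma sample_moment (R : realFieldType) (T : finType) (phi : T -> R) m :
  \sum_b phi b = 0 -> (forall b, `|phi b| <= 1) ->
  \sum_(y : {ffun 'I_m -> T}) (\sum_i phi (y i)) ^+ 2 <= m%:R * #|T|%:R ^+ m.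
Proof.
move=> phi0 phi1; rewrite -[leLHS]/(moment phi 2 m).
have psum1 : psum phi 1 = 0 by rewrite /psum; under eq_bigr => a _ do rewrite expr1.
have psum2 : psum phi 2 <= #|T|%:R.
  rewrite /psum -sum1_card natr_sum; apply: ler_sum => a _.
  by rewrite -real_normK ?num_real // expr_le1.
elim: m => [|m IHm]; first by rewrite momentn0 mul0r.
rewrite moment2 // mulrSr mulrDl mul1r exprS; apply: lerD.
  by rewrite mulrCA ler_wpM2l // ler0n.
by rewrite ler_wpM2r // exprn_ge0 // ler0n.
Qed.

Lemma exists_large (R : realFieldType) (I : finType) (a : I -> R) (c : R) (i0 : I) :
  c * #|I|%:R <= \sum_i a i -> exists i, c <= a i.
Proof.
move=> le_sum; apply/existsP; apply: contraLR le_sum; rewrite negb_exists => /forallP small.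
rewrite -ltNge -sum1_card natr_sum mulr_sumr; apply: ltr_sum => [|i _].
  by apply/hasP; exists i0; rewrite ?mem_index_enum.
by rewrite mulr1 ltNge.
Qed.

(* Croot-Sisask sampling: the average of [m] random translates of [g] approximates [avg B g]
   for most samples, and the good samples on a line [w + t] differ by a translation. *)
Lemma avg_almost_periodic (R : realType) (eps beta : R) : 0 < eps -> 0 < beta ->
  exists2 d : R, 0 < d & forall (F : finZmodType) (B : {set F}) (g : F -> R),
    (forall x, 0 <= g x <= 1) -> beta * #|F|%:R <= #|B|%:R ->
    dense_diff d (fun t => osc (avg B g) t <= eps * #|F|%:R).
Proof.
move=> eps_gt0 beta_gt0.
pose m := (Num.bound (8 / eps ^+ 2)).+1.
have m_large : 8 <= m%:R * eps ^+ 2.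
  rewrite -ler_pdivrMr ?exprn_gt0 //; apply: ltW; apply: lt_trans (_ : (Num.bound (8 / eps ^+ 2))%:R < _).
    by apply: archi_boundP; rewrite divr_ge0 // sqr_ge0.
  by rewrite ltr_nat.
exists (beta ^+ m / 2); first by rewrite divr_gt0 ?exprn_gt0.
move=> F B g g01 B_dense; set N : R := #|F|%:R in B_dense *; set K := avg B g.
have N_gt0 : 0 < N by apply: card_F_gt0.
have B_gt0 : 0 < #|B|%:R :> R by apply: lt_le_trans B_dense; rewrite mulr_gt0.
pose T : finType := {b : F | b \in B}.
have cardT : #|{: T}| = #|B| by rewrite card_sig.
pose phi x (b : T) := g (x + val b) - K x.
pose S (y : {ffun 'I_m -> T}) x := \sum_i phi x (y i).
have moment_le x : \sum_y S y x ^+ 2 <= m%:R * #|B|%:R ^+ m.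
  rewrite -cardT; apply: sample_moment => [|b].
    rewrite sumrB sumr_const cardT /K /avg.
    have -> : \sum_(b : T) g (x + val b) = \sum_(b in B) g (x + b).
      by rewrite [RHS]big_sub.
    by rewrite -[_ *+ _]mulr_natr divfK ?subrr // gt_eqF.
  have := g01 (x + val b); have := avg_itv B x g01; rewrite -/K => /andP[? ?] /andP[? ?].
  by rewrite ler_norml /phi; apply/andP; split; lra.
pose good := [set y : {ffun 'I_m -> T} | \sum_x S y x ^+ 2 <= 2 * N * m%:R].
(* By Markov's inequality at least half of the samples are good. *)
have good_many : #|B|%:R ^+ m / 2 <= #|good|%:R :> R.
  have bad_few : \sum_(y in ~: good) 2 * N * m%:R <= N * (m%:R * #|B|%:R ^+ m).
    apply: (@le_trans _ _ (\sum_y \sum_x S y x ^+ 2)).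
      rewrite [leLHS]big_mkcond; apply: ler_sum => y _; case: ifP => [|_].
        by rewrite !inE -ltNge => /ltW.
      by apply: sumr_ge0 => x _; apply: sqr_ge0.
    rewrite exchange_big /=; apply: le_trans (ler_sum _ (fun x _ => moment_le x)) _.
    by rewrite sumr_const -[leLHS]mulr_natl.
  move: bad_few; rewrite sumr_const -[_ *+ _]mulr_natl.
  have : (#|good| + #|~: good| = #|B| ^ m)%N by rewrite cardsC card_ffun cardT card_ord.
  move/(congr1 (fun j => j%:R : R)); rewrite natrD natrX => <- h.
  have NM_gt0 : 0 < N * m%:R by apply: mulr_gt0 => //; rewrite ltr0n.
  have : 2 * #|~: good|%:R <= #|good|%:R + #|~: good|%:R :> R.
    by rewrite -(ler_pM2l NM_gt0); apply: le_trans (le_trans h _); rewrite le_eqVlt; apply/orP; left; apply/eqP; ring.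
  lra.
have good_close y : y \in good -> \sum_x `|S y x| <= eps / 2 * m%:R * N.
  rewrite inE => y_good.
  have rhs_ge0 : 0 <= eps / 2 * m%:R * N by rewrite !mulr_ge0 ?invr_ge0 ?ler0n // ltW.
  rewrite -(@ler_pXn2r _ 2) ?nnegrE ?sumr_ge0 //.
  apply: le_trans (sum_sqr_le _ _) _; rewrite -/N.
  under eq_bigr => x _ do rewrite real_normK ?num_real //.
  apply: le_trans (ler_wpM2l (ltW N_gt0) y_good) _.
  have -> : (eps / 2 * m%:R * N) ^+ 2 = N ^+ 2 * m%:R * (m%:R * eps ^+ 2) / 4 by field.
  have -> : N * (2 * N * m%:R) = N ^+ 2 * m%:R * 8 / 4 by field.
  by rewrite ler_wpM2r ?invr_ge0 // ler_wpM2l // mulr_ge0 ?sqr_ge0 // ler0n.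
pose line (w : {ffun 'I_m -> F}) t : {ffun 'I_m -> F} := [ffun i => w i + t].
pose inc (y : {ffun 'I_m -> T}) : {ffun 'I_m -> F} := [ffun i => val (y i)].
pose hits w := [set t | line w t \in inc @: good].
(* Average over [w]: for every [t] the same number of [w] put [line w t] among the good samples. *)
have [w w_large] : exists w, beta ^+ m / 2 * N <= #|hits w|%:R.
  apply: (exists_large [ffun=> 0]).
  have -> : \sum_w #|hits w|%:R = N * #|good|%:R :> R.
    under eq_bigr => w _ do rewrite -sum1_card natr_sum big_mkcond.
    rewrite exchange_big /=.
    have inc_inj : injective inc.
      by move=> y z /ffunP e; apply/ffunP => i; apply: val_inj; have := e i; rewrite !ffunE.
    have line_inj t : injective (line^~ t).
      by move=> u v /ffunP e; apply/ffunP => i; have := e i; rewrite !ffunE => /addIr.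
    rewrite (eq_bigr (fun=> #|good|%:R)); first by rewrite sumr_const -[LHS]mulr_natl.
    move=> t _; rewrite -(card_imset good inc_inj) -(card_preimset _ (line_inj t)).
    rewrite -sum1_card natr_sum [RHS]big_mkcond; apply: eq_bigr => w _.
    by rewrite !inE.
  have -> : #|{: {ffun 'I_m -> F}}|%:R = N ^+ m by rewrite card_ffun card_ord natrX.
  apply: le_trans (ler_wpM2l (ltW N_gt0) good_many).
  rewrite [leLHS](_ : _ = N * ((beta * N) ^+ m / 2)); last by rewrite exprMn; move: (beta ^+ m) (N ^+ m) => u v; field.
  rewrite ler_wpM2l ?(ltW N_gt0) // ler_wpM2r ?invr_ge0 //.
  by rewrite ler_pXn2r ?nnegrE ?mulr_ge0 ?ler0n // ltW.
exists (hits w); split=> // t t' tw t'w.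
(* At each hit a translate of the single function [Kw] approximates [K], so two hits are compared
   through [Kw]. *)
pose Kw x := (\sum_i g (x + w i)) / m%:R.
have close s : s \in hits w -> \sum_x `|Kw (x + s) - K x| <= eps / 2 * N.
  rewrite inE => /imsetP[y y_good /ffunP ey].
  rewrite -(ler_pM2r (_ : 0 < m%:R)) ?ltr0n // mulrAC; apply: le_trans (good_close y y_good).
  rewrite mulr_suml; apply: ler_sum => x _.
  rewrite -[X in _ * X]ger0_norm ?ler0n // -normrM mulrBl /Kw divfK ?pnatr_eq0 //.
  rewrite le_eqVlt; apply/orP; left; apply/eqP; congr `|_|.
  rewrite /S /phi sumrB sumr_const card_ord mulr_natr; congr (_ - _); apply: eq_bigr => i _.
  by have := ey i; rewrite !ffunE => <-; rewrite addrA addrAC.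
have -> : eps * N = eps / 2 * N + eps / 2 * N by field.
apply: le_trans (lerD (close _ tw) (close _ t'w)).
rewrite -(sum_translate (- t) (fun x => `|Kw (x + t) - K x|)) -(sum_translate (- t') (fun x => `|Kw (x + t') - K x|)).
rewrite -big_split /= /osc -(sum_translate (- t) (fun x => `|K (x + (t - t')) - K x|)); apply: ler_sum => x _.
rewrite !subrK addrA subrK [leRHS]addrC (distrC (Kw x) (K (x - t'))); exact: ler_distD.
Qed.

Section DenseDiff.
Variables (R : realFieldType) (F : finZmodType).
Implicit Types (P : F -> bool) (d : R).

Lemma dense_diff_sub d P P' : (forall t, P t -> P' t) -> dense_diff d P -> dense_diff d P'.
Proof. by move=> PP' [T [T_dense TP]]; exists T; split=> // t t' tT t'T; apply/PP'/TP. Qed.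

(** On average over [s], the intersection of [T] with [T' + s] has the product density, and its
    differences lie in both difference sets. *)
Lemma dense_diff_and d d' P P' : 0 <= d -> dense_diff d P -> dense_diff d' P' ->
  dense_diff (d * d') (fun t => P t && P' t).
Proof.
move=> d_ge0 [T [T_dense TP]] [T' [T'_dense T'P]].
pose I s := [set x in T | x - s \in T'].
have [s s_large] : exists s, d * d' * #|F|%:R <= #|I s|%:R.
  apply: (exists_large 0).
  have -> : \sum_s #|I s|%:R = #|T|%:R * #|T'|%:R :> R.
    have card_I s : #|I s|%:R = \sum_(x in T) (x - s \in T')%:R :> R.
      rewrite -sum1_card natr_sum [RHS]big_mkcond [LHS]big_mkcond; apply: eq_bigr => x _.
      by rewrite inE; case: (x \in T); case: (_ \in T').
    under eq_bigr => s _ do rewrite card_I.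
    rewrite exchange_big /= mulr_natl -sumr_const; apply: eq_bigr => x _.
    rewrite -(sum_translate x) -(sum_opp (fun s => (x - (s + x) \in T')%:R)).
    rewrite -sum1_card natr_sum [RHS]big_mkcond; apply: eq_bigr => s _.
    by rewrite opprD opprK addrC subrK; case: (_ \in T').
  have N_gt0 := card_F_gt0 R F.
  apply: le_trans (_ : (d * #|F|%:R) * (d' * #|F|%:R) <= _); first by rewrite mulrACA mulrA.
  apply: (@le_trans _ _ (d * #|F|%:R * #|T'|%:R)); first by rewrite ler_wpM2l // mulr_ge0 // ltW.
  by rewrite ler_wpM2r.
exists (I s); split=> // t t'; rewrite !inE => /andP[tT tT'] /andP[t'T t'T'].
by rewrite TP //=; have := T'P _ _ tT' t'T'; rewrite opprB addrA subrK.
Qed.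

Lemma dense_diff_all (J : Type) (s : seq J) d (P : J -> F -> bool) : 0 <= d ->
  (forall j, dense_diff d (P j)) -> dense_diff (d ^+ size s) (fun t => all (P^~ t) s).
Proof.
move=> d_ge0 dP; elim: s => [|j s IHs] /=.
  by exists [set: F]; split=> //; rewrite expr0 mul1r cardsT.
by rewrite exprS; apply: dense_diff_and.
Qed.

(** Ruzsa's covering argument: take a maximal [U] with disjoint translates [u + T], and colour [v]
    by some [u] in [U] whose translate meets [v + T]. *)
Lemma dense_coloring d (T : {set F}) (C : nat) : 0 < d -> d * #|F|%:R <= #|T|%:R -> 1 <= C%:R * d ->
  exists f : F -> 'I_C, forall u v, f u = f v ->
    exists t1 t2 t3 t4, [/\ t1 \in T, t2 \in T, t3 \in T & t4 \in T] /\ u - v = (t1 - t2) - (t3 - t4).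
Proof.
move=> d_gt0 T_dense Cd; have N_gt0 := card_F_gt0 R F.
have T_gt0 : (0 < #|T|)%N by rewrite -(ltr0n R); apply: lt_le_trans T_dense; rewrite mulr_gt0.
pose packing (U : {set F}) := [forall p in setX U T, forall p' in setX U T,
  (p.1 + p.2 == p'.1 + p'.2) ==> (p == p')].
have [U /maxsetP[/'forall_in_forall_inP U_packing U_max]] : {U | maxset packing U}.
  by apply: ex_maxset; exists set0; apply/forall_inP => p; rewrite inE inE.
have U_le : (#|U| <= C)%N.
  have h : (#|U| * #|T| <= #|F|)%N.
    rewrite -cardsX -(@card_in_imset _ _ (fun p => p.1 + p.2)) ?max_card // => p p' pX p'X /eqP.
    by apply: contraTeq => pp'; have := U_packing _ pX _ p'X; case: eqP => //= _ /eqP/eqP; rewrite (negPf pp').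
  rewrite -(ler_nat R) -(ler_pM2r (mulr_gt0 d_gt0 N_gt0)).
  apply: (@le_trans _ _ #|F|%:R); last by rewrite mulrA ler_peMl // ltW.
  by apply: le_trans (_ : (#|U| * #|T|)%:R <= _); rewrite ?ler_nat // natrM ler_wpM2l.
have near_U v : exists u, (u \in U) && [exists a in T, exists b in T, v + a == u + b].
  have [vU|vU] := boolP (v \in U).
    case/card_gt0P: T_gt0 => t tT; exists v; rewrite vU /=; apply/exists_inP; exists t => //.
    by apply/exists_inP; exists t.
  have : ~~ packing (v |: U).
    apply: contra vU => /U_max <-; rewrite ?subsetUr ?setU11 //.
  rewrite negb_forall => /existsP[[u a]]; rewrite negb_imply => /andP[uaX].
  rewrite negb_forall => /existsP[[u' b]]; rewrite negb_imply => /andP[ubX].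
  rewrite negb_imply => /andP[/= /eqP sum_eq neq].
  move: uaX ubX; rewrite !inE /= => /andP[/orP[/eqP uE|uU] aT] /andP[/orP[/eqP u'E|u'U] bT].
  - by move: neq sum_eq; rewrite uE u'E => + /addrI ab; rewrite ab eqxx.
  - exists u'; rewrite u'U; apply/exists_inP; exists a => //; apply/exists_inP; exists b => //.
    by rewrite -uE sum_eq.
  - exists u; rewrite uU; apply/exists_inP; exists b => //; apply/exists_inP; exists a => //.
    by rewrite -u'E sum_eq.
  by have := U_packing (u, a) _ (u', b) _; rewrite !inE /= uU aT u'U bT sum_eq eqxx (negPf neq) => /(_ isT isT).
pose c v := xchoose (near_U v).
have cP v : c v \in U /\ exists a b, [/\ a \in T, b \in T & v + a = c v + b].
  have /andP[cU /exists_inP[a aT /exists_inP[b bT /eqP e]]] := xchooseP (near_U v).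
  by split=> //; exists a, b.
have idx_lt v : (index (c v) (enum U) < C)%N.
  by apply: leq_trans U_le; rewrite cardE index_mem mem_enum; case: (cP v).
exists (fun v => Ordinal (idx_lt v)) => u v /(congr1 val) /= e.
have cuv : c u = c v.
  by rewrite -[c u](nth_index 0 (s := enum U)) ?e ?nth_index // mem_enum; [case: (cP v) | case: (cP u)].
have [_ [a [b [aT bT ua]]]] := cP u; have [_ [a' [b' [a'T b'T va]]]] := cP v.
exists b, a, b', a'; split=> //.
transitivity ((c v + b - a) - (c v + b' - a')).
  by congr (_ - _); [rewrite -cuv -ua addrK | rewrite -va addrK].
by rewrite -(addrA (c v) b) -(addrA (c v) b') opprD addrACA subrr add0r.
Qed.

End DenseDiff.

Lemma dense_diff_scale (R : realFieldType) (F : finFieldType) (d : R) (P : F -> bool) (c : F) :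
  c != 0 -> dense_diff d P -> dense_diff d (fun t => P (c * t)).
Proof.
move=> c0 [T [T_dense TP]]; exists ((fun x => c * x) @^-1: T).
rewrite card_preimset; last exact: mulfI.
by split=> // t t'; rewrite !inE => tT t'T; rewrite mulrBr; apply: TP.
Qed.

(** * Counting solutions *)

Section Solutions.
Variables (R : realType) (F : finFieldType).
Local Notation N := (#|F|%:R : R).
Implicit Types (f : F -> R).

Definition sols n (c : 'I_n -> F) f t : R :=
  \sum_(z : {ffun 'I_n -> F} | \sum_i c i * z i == t) \prod_i f (z i).

Lemma sols_recl n (c : 'I_n.+1 -> F) f t :
  sols c f t = \sum_y f y * sols (fun i => c (lift ord0 i)) f (t - c ord0 * y).
Proof.
rewrite /sols big_mkcond sum_fcons; apply: eq_bigr => y _.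
rewrite mulr_sumr [RHS]big_mkcond; apply: eq_bigr => w _.
have -> : \prod_i f (fcons y w i) = f y * \prod_i f (w i).
  by rewrite big_ord_recl fcons0; congr (_ * _); apply: eq_bigr => i _; rewrite fconsS.
have -> : \sum_i c i * fcons y w i = (\sum_i c (lift ord0 i) * w i) + c ord0 * y.
  by rewrite big_ord_recl fcons0 addrC; congr (_ + _); apply: eq_bigr => i _; rewrite fconsS.
by rewrite eq_sym -subr_eq eq_sym; case: ifP; rewrite ?mulr0.
Qed.

Lemma sols0 (c : 'I_0 -> F) f t : sols c f t = (t == 0)%:R.
Proof.
have all_eq (w : {ffun 'I_0 -> F}) : w = [ffun=> 0] by apply/ffunP => -[].
rewrite /sols big_mkcond (big_pred1 [ffun=> 0]) => [|w]; last by apply/esym/eqP.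
by rewrite !big_ord0 eq_sym; case: eqP.
Qed.

Lemma sols1 (c : 'I_1 -> F) f t : c ord0 != 0 -> sols c f t = f (t / c ord0).
Proof.
move=> c0; rewrite sols_recl (bigD1 (t / c ord0)) //= sols0.
rewrite [c ord0 * _]mulrC divfK // subrr eqxx mulr1 big1 ?addr0 // => y yt.
rewrite sols0 subr_eq0; case: eqP => [e|]; last by rewrite mulr0.
by move: yt; rewrite e mulrAC divff // mul1r eqxx.
Qed.

Lemma sum_affine (a b : F) (h : F -> R) : a != 0 -> \sum_y h (b - a * y) = \sum_x h x.
Proof.
move=> a0; rewrite [RHS](reindex_inj (_ : injective (fun y => b - a * y))) //.
by move=> u v /addrI/oppr_inj/(mulfI a0).
Qed.

Lemma sols_ge0 n (c : 'I_n -> F) f t : (forall x, 0 <= f x) -> 0 <= sols c f t.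
Proof. by move=> f0; apply: sumr_ge0 => z _; apply: prodr_ge0 => i _. Qed.

(** Peel off variables down to the last two: each is a convolution with values in [[0, 1]] and costs
    at most a factor [N]. *)
Lemma osc_sols n (c : 'I_n.+2 -> F) : (forall i, c i != 0) ->
  exists2 c2 : 'I_2 -> F, (forall i, c2 i != 0) &
  forall f, (forall x, 0 <= f x <= 1) -> forall t, osc (sols c f) t <= N ^+ n * osc (sols c2 f) t.
Proof.
elim: n c => [|n IHn] c c0; first by exists c => // f _ t; rewrite expr0 mul1r.
have [c2 c2_0 h] := IHn (fun i => c (lift ord0 i)) (fun i => c0 _).
exists c2 => // f f01 t; rewrite exprS -mulrA; apply: le_trans (ler_wpM2l _ (h f f01 t)); last exact: ler0n.
rewrite /osc; under eq_bigr => x _ do rewrite !sols_recl -sumrB.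
apply: (@le_trans _ _ (\sum_x \sum_y `|sols (fun i => c (lift ord0 i)) f (x + t - c ord0 * y) -
    sols (fun i => c (lift ord0 i)) f (x - c ord0 * y)|)).
  apply: ler_sum => x _; apply: le_trans (ler_norm_sum _ _ _) _; apply: ler_sum => y _.
  rewrite -mulrBr normrM; case/andP: (f01 y) => f0 f1.
  by rewrite ger0_norm // ler_piMl.
rewrite exchange_big /= mulr_natl -sumr_const ler_sum // => y _.
rewrite -(sum_translate (c ord0 * y)) le_eqVlt; apply/orP; left; apply/eqP.
by apply: eq_bigr => x _; rewrite addrK addrAC addrK.
Qed.

(** One further convolution turns the L1 bound into a uniform one. *)
Lemma sols_shift_le n (c : 'I_n.+3 -> F) : (forall i, c i != 0) ->
  exists2 c2 : 'I_2 -> F, (forall i, c2 i != 0) &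
  forall f, (forall x, 0 <= f x <= 1) -> forall t x,
    `|sols c f (x + t) - sols c f x| <= N ^+ n * osc (sols c2 f) t.
Proof.
move=> c0; have [c2 c2_0 h] := osc_sols (fun i => c0 (lift ord0 i)).
exists c2 => // f f01 t x; apply: le_trans (h f f01 t).
rewrite !sols_recl -sumrB; apply: le_trans (ler_norm_sum _ _ _) _.
set g := sols (fun i => c (lift ord0 i)) f.
rewrite /osc -(sum_affine x (fun v => `|g (v + t) - g v|) (c0 ord0)); apply: ler_sum => y _.
rewrite -mulrBr normrM; case/andP: (f01 y) => f0 f1.
by rewrite ger0_norm // [x + t - _]addrAC ler_piMl.
Qed.

Definition ind (A : {set F}) (x : F) : R := (x \in A)%:R.

Lemma ind_itv A x : 0 <= ind A x <= 1.
Proof. by rewrite /ind; case: (x \in A); rewrite ?lexx ?ler01. Qed.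

Lemma sum_ind A : \sum_x ind A x = #|A|%:R.
Proof. by rewrite -sum1_card natr_sum [RHS]big_mkcond; apply: eq_bigr => x _; rewrite /ind; case: ifP. Qed.

Lemma sols2_avg (A : {set F}) (c : 'I_2 -> F) x : (forall i, c i != 0) ->
  sols c (ind A) x = #|A|%:R * avg [set - (c ord0 * y) | y in A] (fun v => ind A (v / c ord_max)) x.
Proof.
move=> c0; have lin_inj : injective (fun y => - (c ord0 * y)) by move=> u v /oppr_inj/(mulfI (c0 _)).
rewrite /avg card_imset //; have [A0|A_gt0] := posnP #|A|.
  rewrite A0 mul0r sols_recl big1 // => y _.
  by rewrite /ind (card0_eq A0) mul0r.
rewrite mulrC divfK ?pnatr_eq0 -?lt0n // big_imset /=; last by move=> ? ? _ _; apply: lin_inj.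
rewrite sols_recl [RHS]big_mkcond; apply: eq_bigr => y _.
rewrite {1}/ind; case: ifP => _; rewrite ?mul0r // mul1r.
by rewrite sols1 // -(_ : ord_max = lift ord0 ord0) ?c0 //; apply: val_inj.
Qed.

End Solutions.

Lemma sols_almost_periodic (R : realType) (eps alpha : R) : 0 < eps -> 0 < alpha ->
  exists2 d : R, 0 < d & forall (F : finFieldType) (A : {set F}) n (c : 'I_n.+3 -> F),
    (forall i, c i != 0) -> alpha * #|F|%:R <= #|A|%:R ->
    dense_diff d (fun t => [forall x,
      `|sols c (ind R A) (x + t) - sols c (ind R A) x| <= eps * #|F|%:R ^+ n.+2]).
Proof.
move=> eps_gt0 alpha_gt0; have [d d_gt0 ap] := avg_almost_periodic eps_gt0 alpha_gt0.
exists d => // F A n c c0 A_dense; have [c2 c2_0 shift_le] := sols_shift_le R c0.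
pose B := [set - (c2 ord0 * y) | y in A].
have cardB : #|B| = #|A| by rewrite card_imset // => u v /oppr_inj/(mulfI (c2_0 _)).
have := ap F B (fun v => ind R A (v / c2 ord_max)) (fun x => ind_itv R A _).
rewrite cardB => /(_ A_dense); apply: dense_diff_sub => t osc_le; apply/forallP => x.
apply: le_trans (shift_le _ (ind_itv R A) t x) _.
have -> : eps * #|F|%:R ^+ n.+2 = #|F|%:R ^+ n * (#|F|%:R * (eps * #|F|%:R)) by rewrite !exprS; ring.
rewrite ler_wpM2l ?exprn_ge0 ?ler0n //.
have -> : osc (sols c2 (ind R A)) t = #|A|%:R * osc (avg B (fun v => ind R A (v / c2 ord_max))) t.
  rewrite /osc mulr_sumr; apply: eq_bigr => y _; rewrite !sols2_avg // -mulrBr normrM.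
  by rewrite [`|#|A|%:R|]ger0_norm.
by apply: ler_pM; rewrite ?osc_ge0 ?ler0n ?ler_nat ?max_card.
Qed.

(** * Smoothing and energy increment *)

Section Smoothing.
Variables (R : realType) (F : finFieldType).
Local Notation N := (#|F|%:R : R).
Implicit Types (f g h : F -> R) (T : {set F}).

(** The adjoint of [avg T], so that [smooth T] is self-adjoint and averages over all differences of
    elements of [T]. *)
Definition avgm T g x : R := (\sum_(b in T) g (x - b)) / #|T|%:R.
Definition smooth T g := avg T (avgm T g).

Lemma dot_avg T g h : \sum_x g x * avg T h x = \sum_x avgm T g x * h x.
Proof.
rewrite /avg /avgm; under eq_bigr => x _ do rewrite mulrA mulr_sumr mulr_suml.
under [RHS]eq_bigr => x _ do rewrite mulrAC mulr_suml mulr_suml.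
rewrite exchange_big [RHS]exchange_big /=; apply: eq_bigr => b _.
by rewrite -[RHS](sum_translate b); apply: eq_bigr => x _; rewrite addrK.
Qed.

Lemma dot_smooth T g h : \sum_x g x * smooth T h x = \sum_x smooth T g x * h x.
Proof.
rewrite dot_avg; under [RHS]eq_bigr => x _ do rewrite mulrC.
by rewrite dot_avg; apply: eq_bigr => x _; rewrite mulrC.
Qed.

Lemma avg_contract T g : \sum_x avg T g x ^+ 2 <= \sum_x g x ^+ 2.
Proof.
have [T0|T_gt0] := posnP #|T|.
  rewrite big1 ?sumr_ge0 // => [x _|x _]; first exact: sqr_ge0.
  by rewrite /avg T0 invr0 mulr0 expr0n.
have T_gt0' : 0 < #|T|%:R :> R by rewrite ltr0n.
apply: (@le_trans _ _ (\sum_x \sum_(b in T) g (x + b) ^+ 2 / #|T|%:R)).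
  apply: ler_sum => x _; rewrite /avg expr_div_n ler_pdivrMr ?exprn_gt0 // -mulr_suml.
  by apply: le_trans (sum_sqr_le _ _) _; rewrite expr2 -mulrA mulKf ?gt_eqF // mulrC.
rewrite exchange_big /=; under eq_bigr => b _ do rewrite -mulr_suml (sum_translate b (fun x => g x ^+ 2)).
by rewrite sumr_const -[_ *+ _]mulr_natr divfK ?gt_eqF.
Qed.

Lemma avgm_itv T g x : (forall y, 0 <= g y <= 1) -> 0 <= avgm T g x <= 1.
Proof.
move=> g01; have := @avg_itv R F T (fun y => g (- y)) (- x) (fun y => g01 _).
by rewrite /avg /avgm; under eq_bigr => b _ do rewrite opprD opprK.
Qed.

Lemma smooth_itv T g x : (forall y, 0 <= g y <= 1) -> 0 <= smooth T g x <= 1.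
Proof. by move=> g01; apply: avg_itv => y; apply: avgm_itv. Qed.

Lemma sum_smooth T g : (0 < #|T|)%N -> \sum_x smooth T g x = \sum_x g x.
Proof.
move=> T_gt0; have T0 : #|T|%:R != 0 :> R by rewrite pnatr_eq0 -lt0n.
rewrite -[RHS]mul1r -[LHS]mul1r !mulr_sumr dot_smooth; apply: eq_bigr => x _.
congr (_ * _); rewrite /smooth /avg /avgm.
under eq_bigr => b _ do rewrite sumr_const -[1 *+ _]mulr_natl mulr1 divff //.
by rewrite sumr_const divff.
Qed.

Definition energy T f : R := \sum_x smooth T f x ^+ 2.

(** The energy is the squared norm of [avg T (avgm T f)], and averaging contracts. *)
Lemma energy_le_dot T f : energy T f <= \sum_x f x * smooth T f x.
Proof.
rewrite dot_avg; apply: le_trans (avg_contract T (avgm T f)) _.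
by rewrite le_eqVlt; apply/orP; left; apply/eqP; apply: eq_bigr => x _; rewrite expr2.
Qed.

Lemma energy_le f T : (forall x, 0 <= f x <= 1) -> energy T f <= N.
Proof.
move=> f01; rewrite /energy -sum1_card natr_sum; apply: ler_sum => x _.
by have /andP[? ?] := smooth_itv T x f01; rewrite expr_le1.
Qed.

Lemma smooth_close T g e : (0 < #|T|)%N ->
  (forall t t', t \in T -> t' \in T -> osc g (t - t') <= e) ->
  \sum_x `|smooth T g x - g x| <= e.
Proof.
move=> T_gt0 osc_le; have T0 : 0 < #|T|%:R :> R by rewrite ltr0n.
have smoothE x : smooth T g x - g x =
    (\sum_(b in T) \sum_(b' in T) (g (x + (b - b')) - g x)) / #|T|%:R ^+ 2.
  rewrite /smooth /avg /avgm -mulr_suml -mulrA -invfM -expr2.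
  under [in RHS]eq_bigr => b _ do rewrite sumrB sumr_const.
  rewrite sumrB sumr_const; have -> : g x *+ #|T| *+ #|T| = g x * #|T|%:R ^+ 2.
    by rewrite expr2 mulrA !mulr_natr.
  rewrite mulrBl mulfK ?expf_neq0 ?gt_eqF //.
  by congr (_ / _ - _); apply: eq_bigr => b _; apply: eq_bigr => b' _; rewrite addrA.
under eq_bigr => x _ do rewrite smoothE normrM [`|_^-1|]ger0_norm ?invr_ge0 ?exprn_ge0 ?ltW //.
rewrite -mulr_suml ler_pdivrMr ?exprn_gt0 //.
apply: (@le_trans _ _ (\sum_x \sum_(b in T) \sum_(b' in T) `|g (x + (b - b')) - g x|)).
  apply: ler_sum => x _; apply: le_trans (ler_norm_sum _ _ _) _.
  by apply: ler_sum => b _; apply: ler_norm_sum.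
rewrite exchange_big /=; under eq_bigr => b _ do rewrite exchange_big /=.
apply: (@le_trans _ _ (\sum_(b in T) \sum_(b' in T) e)).
  by apply: ler_sum => b bT; apply: ler_sum => b' b'T; apply: osc_le.
by rewrite !sumr_const expr2 mulrA !mulr_natr.
Qed.

(* [smooth T] is positive and at most the identity, so [energy_le_dot] plays the role of the
   orthogonality of nested projections. *)
Lemma energy_increment T T1 f e : (0 < #|T1|)%N -> (forall x, 0 <= f x <= 1) ->
  (forall t t', t \in T1 -> t' \in T1 -> osc (smooth T f) (t - t') <= e) ->
  \sum_x (smooth T1 f x - smooth T f x) ^+ 2 <= energy T1 f - energy T f + 2 * e.
Proof.
move=> T1_gt0 f01 osc_le; set G := smooth T f; set G1 := smooth T1 f.
have -> : \sum_x (G1 x - G x) ^+ 2 = energy T1 f + energy T f - 2 * \sum_x G1 x * G x.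
  rewrite /energy mulr_sumr -big_split -sumrB /=; apply: eq_bigr => x _; rewrite -/G -/G1; ring.
have close := smooth_close T1_gt0 osc_le; rewrite -/G in close.
suff : energy T f - e <= \sum_x G1 x * G x by lra.
rewrite /G1 -dot_smooth; apply: (@le_trans _ _ (\sum_x f x * G x - e)).
  by rewrite lerD2r energy_le_dot.
rewrite lerBlDr -lerBlDl -sumrB; apply: le_trans close; apply: ler_sum => x _.
rewrite -mulrBr distrC; have /andP[f0 f1] := f01 x.
by apply: le_trans (ler_norm _) _; rewrite normrM ger0_norm // ler_piMl.
Qed.

End Smoothing.

Lemma prod_itv (R : realFieldType) (I : Type) (s : seq I) (a : I -> R) :
  (forall i, 0 <= a i <= 1) -> 0 <= \prod_(i <- s) a i <= 1.
Proof.
move=> a01; apply: (big_ind (fun x => 0 <= x <= 1)) => //; first by rewrite ler01 lexx.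
by move=> x y /andP[x0 x1] /andP[y0 y1]; rewrite mulr_ge0 // mulr_ile1.
Qed.

Lemma prod_dist (R : realFieldType) (I : Type) (s : seq I) (a b : I -> R) :
  (forall i, 0 <= a i <= 1) -> (forall i, 0 <= b i <= 1) ->
  `|\prod_(i <- s) a i - \prod_(i <- s) b i| <= \sum_(i <- s) `|a i - b i|.
Proof.
move=> a01 b01; elim: s => [|i s IHs]; first by rewrite !big_nil subrr normr0.
rewrite !big_cons; set P := \prod_(j <- s) a j in IHs *; set P' := \prod_(j <- s) b j in IHs *.
have /andP[P0 P1] := prod_itv s a01; have /andP[b0 b1] := b01 i; rewrite -/P in P0 P1.
have -> : a i * P - b i * P' = (a i - b i) * P + b i * (P - P') by ring.
apply: le_trans (ler_normD _ _) (lerD _ _); rewrite normrM ?(ger0_norm P0) ?(ger0_norm b0).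
  by rewrite ler_piMr.
by apply: le_trans IHs; rewrite ler_piMl.
Qed.

Lemma expr_tangent (R : realFieldType) (x y : R) n : 0 <= x -> 0 <= y ->
  y ^+ n + n%:R * y ^+ n.-1 * (x - y) <= x ^+ n.
Proof.
move=> x0 y0; elim: n => [|n IHn]; first by rewrite !mul0r addr0.
rewrite [x ^+ _]exprS; apply: le_trans (ler_wpM2l x0 IHn); rewrite -subr_ge0 /=.
case: n {IHn} => [|n] /=; first by rewrite expr1 !expr0 !mul0r !mul1r; lra.
rewrite !exprS -[n.+2%:R]natr1; set u := y ^+ n; set k := n.+1%:R.
have -> : x * (y * u + k * u * (x - y)) - (y * (y * u) + (k + 1) * (y * u) * (x - y)) =
  k * u * (x - y) ^+ 2 by ring.
by apply: mulr_ge0 (sqr_ge0 _); apply: mulr_ge0; rewrite ?exprn_ge0 ?ler0n.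
Qed.

Section Lower.
Variables (R : realType) (F : finFieldType) (n : nat) (c : 'I_n -> F).
Local Notation N := (#|F|%:R : R).

Lemma walk_le (h : F -> R) (e : R) (s : seq 'I_n) (v : 'I_n -> F) x :
  (forall i y, h (y + v i) <= h y + e) -> h (x + \sum_(i <- s) v i) <= h x + (size s)%:R * e.
Proof.
move=> step; elim: s x => [|i s IHs] x; first by rewrite big_nil addr0 mul0r addr0.
rewrite big_cons addrA; apply: le_trans (IHs _) _.
by rewrite /= -natr1 mulrDl mul1r [_ * e + e]addrC addrA lerD2r.
Qed.

(** Expanding every factor, the left side is an average of [sols c f] over points reached from 0 in
    [n] steps [c i * (t - t')]. *)
Lemma sols_smooth_le (T : {set F}) (f : F -> R) (e : R) : (0 < #|T|)%N ->
  (forall i t t', t \in T -> t' \in T -> forall x, sols c f (x + c i * (t - t')) <= sols c f x + e) ->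
  sols c (smooth T f) 0 <= sols c f 0 + n%:R * e.
Proof.
move=> T_gt0 step; have T0 : #|T|%:R != 0 :> R by rewrite pnatr_eq0 -lt0n.
pose TT : finType := {x : F | x \in T}; pose J : finType := (TT * TT)%type.
pose dl (j : J) : F := val j.1 - val j.2; pose w : R := #|T|%:R ^- 2.
have smoothE z : smooth T f z = \sum_(j : J) f (z + dl j) * w.
  rewrite -(pair_big xpredT xpredT (fun a b : TT => f (z + (val a - val b)) * w)) /=.
  rewrite /smooth /avg mulr_suml big_sub; apply: eq_bigr => a _.
  rewrite /avgm !mulr_suml big_sub; apply: eq_bigr => b _.
  by rewrite -mulrA -invfM -expr2 addrA.
have -> : sols c (smooth T f) 0 = \sum_(phi : {ffun 'I_n -> J}) w ^+ n * sols c f (\sum_i c i * dl (phi i)).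
  rewrite /sols; under eq_bigr => z _ do under eq_bigr => i _ do rewrite smoothE.
  under eq_bigr => z _ do rewrite bigA_distr_bigA /=.
  rewrite exchange_big /=; apply: eq_bigr => phi _.
  rewrite mulr_sumr [RHS](reindex_inj (_ : injective (fun z : {ffun 'I_n -> F} => [ffun i => z i + dl (phi i)]))); last first.
    by move=> u v /ffunP h; apply/ffunP => i; have := h i; rewrite !ffunE => /addIr.
  rewrite [RHS](eq_bigl (fun z : {ffun 'I_n -> F} => \sum_i c i * z i == 0)); last first.
    move=> z; under eq_bigr => i _ do rewrite ffunE mulrDr.
    by rewrite big_split /= -[X in _ == X]add0r (inj_eq (addIr _)).
  apply: eq_bigr => z _; rewrite big_split /= prodr_const card_ord [LHS]mulrC.
  by congr (_ * _); apply: eq_bigr => i _; rewrite ffunE.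
have -> : sols c f 0 + n%:R * e = \sum_(phi : {ffun 'I_n -> J}) w ^+ n * (sols c f 0 + n%:R * e).
  have cardJ : #|J| = (#|T| * #|T|)%N by rewrite card_prod card_sig.
  rewrite sumr_const card_ffun card_ord cardJ -[RHS]mulr_natl natrX natrM -expr2.
  by rewrite [RHS]mulrA -exprMn divff ?expr1n ?mul1r // expf_neq0.
apply: ler_sum => phi _; rewrite ler_wpM2l ?exprn_ge0 ?invr_ge0 ?exprn_ge0 //.
have := @walk_le (sols c f) e (index_enum 'I_n) (fun i => c i * dl (phi i)) 0.
rewrite add0r -[size _]/(size (index_enum 'I_n)) [index_enum _]unlock -enumT size_enum_ord; apply.
by move=> i y; apply: step; apply: valP.
Qed.

(* Restrict to the solutions [x + (d i - d' i)] with [\sum_i c i * d i = \sum_i c i * d' i], on which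
   all the values of [G] are almost equal to [G x]. *)
Lemma sols_lower (D : {set F}) (G G1 : F -> R) (alpha eta : R) :
  \sum_i c i = 0 -> (forall x, 0 <= G x <= 1) -> (forall x, 0 <= G1 x <= 1) -> 0 <= alpha ->
  alpha * N <= \sum_x G x -> \sum_x `|G1 x - G x| <= eta * N ->
  (forall d d', d \in D -> d' \in D -> osc G (d - d') <= eta * N) ->
  0 <= alpha ^+ n - 2 * n%:R * eta ->
  #|D|%:R ^+ n * (alpha ^+ n - 2 * n%:R * eta) <= N * sols c G1 0.
Proof.
move=> c_sum0 G01 G1_01 alpha_ge0 G_dense G1_close G_osc.
set lam := alpha ^+ n - _ => lam_ge0.
have N_gt0 : 0 < N := card_F_gt0 R F.
pose onD : pred {ffun 'I_n -> F} := [in ffun_on (mem D)].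
have onDP d i : onD d -> d i \in D by move/ffun_onP.
pose L (d : {ffun 'I_n -> F}) := \sum_i c i * d i.
pose W (d d' : {ffun 'I_n -> F}) x := \prod_i G1 (x + (d i - d' i)).
(* Replacing a factor by [G x] costs [2 eta N]; the tangent to the power at [alpha] bounds what is
   left. *)
have lower d d' : onD d -> onD d' -> N * lam <= \sum_x W d d' x.
  move=> dD d'D.
  have diff : \sum_x `|W d d' x - G x ^+ n| <= 2 * n%:R * eta * N.
    apply: (@le_trans _ _ (\sum_x \sum_(i < n) `|G1 (x + (d i - d' i)) - G x|)).
      apply: ler_sum => x _; rewrite -[n in G x ^+ n]card_ord -prodr_const.
      exact: prod_dist.
    rewrite exchange_big /=.
    apply: (@le_trans _ _ (\sum_(i < n) (2 * eta * N))); last first.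
      by rewrite sumr_const card_ord -mulr_natl le_eqVlt; apply/orP; left; apply/eqP; ring.
    apply: ler_sum => i _; set s := d i - d' i.
    apply: (@le_trans _ _ (\sum_x `|G1 (x + s) - G (x + s)| + osc G s)).
      by rewrite /osc -big_split /=; apply: ler_sum => x _; apply: ler_distD.
    rewrite (sum_translate s (fun x => `|G1 x - G x|)) -mulrA mulr_natl mulr2n.
    by apply: lerD => //; apply: G_osc; apply: onDP.
  have powers : N * alpha ^+ n <= \sum_x G x ^+ n.
    apply: (@le_trans _ _ (\sum_x (alpha ^+ n + n%:R * alpha ^+ n.-1 * (G x - alpha)))); last first.
      by apply: ler_sum => x _; apply: expr_tangent => //; case/andP: (G01 x).
    rewrite big_split /= sumr_const -mulr_sumr sumrB !sumr_const -[alpha ^+ n *+ _]mulr_natl lerDl.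
    by rewrite !mulr_ge0 ?exprn_ge0 // subr_ge0 -mulr_natr.
  have : \sum_x G x ^+ n - \sum_x W d d' x <= 2 * n%:R * eta * N.
    rewrite -sumrB; apply: le_trans diff; apply: ler_sum => x _.
    by rewrite distrC; apply: ler_norm.
  rewrite /lam mulrBr; move: powers; rewrite [N * (2 * _ * _)]mulrC; lra.
(* For fixed [d'] and [x], distinct [d] give distinct points, which are solutions because [c] sums
   to zero. *)
have upper d' x : \sum_(d | onD d && (L d == L d')) W d d' x <= sols c G1 0.
  apply: (@le_trans _ _ (\sum_(d | L d == L d') W d d' x)).
    rewrite [leLHS]big_mkcond [leRHS]big_mkcond; apply: ler_sum => d _.
    have W0 : 0 <= W d d' x by apply: prodr_ge0 => i _; case/andP: (G1_01 (x + (d i - d' i))).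
    by case: (onD d); case: (L d == _).
  rewrite /sols [leRHS](reindex_inj (_ : injective (fun d : {ffun 'I_n -> F} => [ffun i => x + (d i - d' i)]))).
    rewrite [leRHS](eq_bigl (fun d => L d == L d')).
      by apply: ler_sum => d _; rewrite le_eqVlt; apply/orP; left; apply/eqP; apply: eq_bigr => i _; rewrite ffunE.
    move=> d; under eq_bigr => i _ do rewrite ffunE mulrDr mulrBr.
    by rewrite big_split /= -mulr_suml c_sum0 mul0r add0r sumrB subr_eq0.
  by move=> u v /ffunP h; apply/ffunP => i; have := h i; rewrite !ffunE => /addrI/addIr.
pose pairs : R := \sum_(d' | onD d') \sum_(d | onD d && (L d == L d')) 1.
(* Cauchy-Schwarz over the [N] possible values of [L]. *)
have pairs_ge : #|D|%:R ^+ n * #|D|%:R ^+ n <= N * pairs.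
  pose cnt t : R := \sum_(d | onD d && (L d == t)) 1.
  have sum_cnt : \sum_t cnt t = #|D|%:R ^+ n.
    rewrite /cnt -(partition_big L xpredT) //= sumr_const.
    by rewrite (card_ffun_on 'I_n (mem D)) card_ord natrX.
  have -> : pairs = \sum_t cnt t ^+ 2.
    rewrite /pairs (partition_big L xpredT) //=; apply: eq_bigr => t _.
    rewrite (eq_bigr (fun=> cnt t)); last by move=> d /andP[_ /eqP<-].
    by rewrite expr2 {2}/cnt mulr_sumr; apply: eq_bigr => d _; rewrite mulr1.
  by rewrite -expr2 -sum_cnt; apply: sum_sqr_le.
have main : N * lam * pairs <= #|D|%:R ^+ n * (N * sols c G1 0).
  apply: (@le_trans _ _ (\sum_(d' | onD d') \sum_x \sum_(d | onD d && (L d == L d')) W d d' x)).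
    rewrite /pairs mulr_sumr; apply: ler_sum => d' d'D.
    rewrite exchange_big mulr_sumr /=; apply: ler_sum => d /andP[dD _].
    by rewrite mulr1; apply: lower.
  apply: (@le_trans _ _ (\sum_(d' | onD d') \sum_(x : F) sols c G1 0)).
    by apply: ler_sum => d' _; apply: ler_sum => x _; apply: upper.
  by rewrite !sumr_const (card_ffun_on _ (mem D)) card_ord -[_ *+ (_ ^ _)]mulr_natl natrX -[sols c G1 0 *+ _]mulr_natl.
have [D0|D_neq0] := eqVneq (#|D|%:R ^+ n : R) 0.
  by rewrite D0 mul0r mulr_ge0 ?ler0n // sols_ge0 // => x; case/andP: (G1_01 x).
have D_gt0 : 0 < (#|D|%:R ^+ n : R) by rewrite lt_def D_neq0 exprn_ge0.
rewrite -(ler_pM2l D_gt0); apply: le_trans main.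
by rewrite mulrA [N * lam]mulrC -[leRHS]mulrA mulrC ler_wpM2l.
Qed.

End Lower.

(** * Roth's theorem in Varnavides' form *)

Section Roth.
Variables (R : realType) (alpha : R) (n : nat).
Hypothesis alpha_gt0 : 0 < alpha.
Local Notation r := n.+3.
(** This makes the loss [2 r eta] half of [alpha ^ r]. A change above [eta ^ 2 N = 3 kappa N], less
    the error [2 kappa N], raises the energy by [kappa N]. *)
Let eta : R := alpha ^+ r / (4 * r%:R).
Let kappa : R := eta ^+ 2 / 3.

Lemma eta_gt0 : 0 < eta.
Proof. by rewrite divr_gt0 ?exprn_gt0 // mulr_gt0 ?ltr0n. Qed.

Lemma kappa_gt0 : 0 < kappa.
Proof. by rewrite divr_gt0 ?exprn_gt0 ?eta_gt0. Qed.

(* Choose [T1] with almost periods far finer than those of [smooth T].  Either smoothing by [T1]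
   changes little, and the solutions of [smooth T1] are controlled by the almost periods of
   [smooth T], or the energy increases by [kappa], which happens at most [1 / kappa] times. *)
Lemma sols_large_energy m (tau : R) : 0 < tau ->
  exists2 d : R, 0 < d & forall (F : finFieldType) (A T : {set F}) (c : 'I_r -> F),
    (forall i, c i != 0) -> \sum_i c i = 0 -> alpha * #|F|%:R <= #|A|%:R ->
    tau * #|F|%:R <= #|T|%:R -> (1 - m%:R * kappa) * #|F|%:R < energy T (ind R A) ->
    d * #|F|%:R ^+ n.+2 <= sols c (ind R A) 0.
Proof.
elim: m tau => [|m IHm] tau tau_gt0.
  exists 1 => // F A T c _ _ _ _; rewrite mul0r subr0 mul1r ltNge energy_le //; exact: ind_itv.
have [b b_gt0 apD] := avg_almost_periodic eta_gt0 tau_gt0.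
(* With this [eps] the [r] steps of [sols_smooth_le] lose half of the bound from [sols_lower]. *)
pose eps := b ^+ r * alpha ^+ r / (4 * r%:R).
have r_gt0 : 0 < r%:R :> R by rewrite ltr0n.
have ba_gt0 : 0 < b ^+ r * alpha ^+ r by apply: mulr_gt0; apply: exprn_gt0.
have eps_gt0 : 0 < eps by apply: divr_gt0 => //; apply: mulr_gt0.
have [d1 d1_gt0 apS] := sols_almost_periodic eps_gt0 alpha_gt0.
have [d2 d2_gt0 apK] := avg_almost_periodic kappa_gt0 tau_gt0.
have tau1_gt0 : 0 < d1 ^+ r * d2 by apply: mulr_gt0 => //; apply: exprn_gt0.
have [d3 d3_gt0 IH] := IHm _ tau1_gt0.
have e0_gt0 : 0 < b ^+ r * alpha ^+ r / 4 by apply: divr_gt0.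
exists (Num.min d3 (b ^+ r * alpha ^+ r / 4)); first by rewrite lt_min d3_gt0.
move=> F A T c c0 c_sum0 A_dense T_dense T_energy.
set N : R := #|F|%:R in A_dense T_dense T_energy *.
have N_gt0 : 0 < N := card_F_gt0 R F.
have f01 := @ind_itv R F A; set f := ind R A in T_energy f01 *.
have T_gt0 : (0 < #|T|)%N by rewrite -(ltr0n R); apply: lt_le_trans T_dense; rewrite mulr_gt0.
have g01 x : 0 <= avgm T f x <= 1 by apply: avgm_itv.
have [D [D_dense D_osc]] := apD F T (avgm T f) g01 T_dense.
have size_r : size (enum 'I_r) = r by rewrite size_enum_ord.
have d1r_ge0 : 0 <= d1 ^+ size (enum 'I_r) by rewrite exprn_ge0 // ltW.
have := dense_diff_and d1r_ge0
  (dense_diff_all (enum 'I_r) (ltW d1_gt0) (fun i => dense_diff_scale (c0 i) (apS F A n c c0 A_dense)))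
  (apK F T (avgm T f) g01 T_dense).
rewrite size_r => -[T1 [T1_dense T1_per]].
have T1_gt0 : (0 < #|T1|)%N by rewrite -(ltr0n R); apply: lt_le_trans T1_dense; rewrite mulr_gt0.
have T1_sols i t t' : t \in T1 -> t' \in T1 -> forall x,
    sols c f (x + c i * (t - t')) <= sols c f x + eps * N ^+ n.+2.
  move=> tT t'T x; have /andP[/allP/(_ i) + _] := T1_per t t' tT t'T.
  rewrite mem_enum => /(_ isT)/forallP/(_ x) h.
  by rewrite -lerBlDl; apply: le_trans (ler_norm _) h.
have T1_osc t t' : t \in T1 -> t' \in T1 -> osc (smooth T f) (t - t') <= kappa * N.
  by move=> tT t'T; case/andP: (T1_per t t' tT t'T).
have incr := energy_increment T1_gt0 f01 T1_osc.
have kE : eta ^+ 2 = 3 * kappa by rewrite /kappa; field.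
have [far|close] := ltP (eta ^+ 2 * N) (\sum_x (smooth T1 f x - smooth T f x) ^+ 2).
  apply: (@le_trans _ _ (d3 * N ^+ n.+2)); first by rewrite ler_wpM2r ?exprn_ge0 ?(ltW N_gt0) // ge_min lexx.
  apply: (IH F A T1 c) => //; have := lt_le_trans far incr; move: T_energy.
  rewrite kE -natr1 !mulrBl !mulrDl !mul1r -/f -/N.
  by move: (energy T1 f) (energy T f) (kappa * N) (m%:R * kappa * N) => ? ? ? ?; lra.
have close1 : \sum_x `|smooth T1 f x - smooth T f x| <= eta * N.
  have eN : 0 <= eta * N by rewrite mulr_ge0 ?(ltW eta_gt0) ?(ltW N_gt0).
  rewrite -(@ler_pXn2r _ 2) ?nnegrE ?sumr_ge0 //.
  apply: le_trans (sum_sqr_le _ _) _; rewrite -/N.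
  under eq_bigr => x _ do rewrite real_normK ?num_real //.
  apply: le_trans (ler_wpM2l (ltW N_gt0) close) _.
  by rewrite le_eqVlt; apply/orP; left; apply/eqP; ring.
have lamE : alpha ^+ r - 2 * r%:R * eta = alpha ^+ r / 2.
  by rewrite /eta; move: (alpha ^+ r) (r%:R : R) r_gt0 => u k k_gt0; field; rewrite gt_eqF.
have := sols_lower c_sum0 (fun x => smooth_itv T x f01) (fun x => smooth_itv T1 x f01) (ltW alpha_gt0)
  _ close1 D_osc.
rewrite sum_smooth // sum_ind lamE => /(_ A_dense) low.
have {}low := low (ltW (divr_gt0 (exprn_gt0 _ alpha_gt0) (ltr0n R 2))).
have up := sols_smooth_le T1_gt0 T1_sols.
have D_pow : b ^+ r * N ^+ r <= #|D|%:R ^+ r.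
  by rewrite -exprMn ler_pXn2r ?nnegrE ?mulr_ge0 ?ler0n // ltW.
apply: (@le_trans _ _ (b ^+ r * alpha ^+ r / 4 * N ^+ n.+2)).
  by rewrite ler_wpM2r ?exprn_ge0 ?(ltW N_gt0) // ge_min lexx orbT.
have low2 : N * (b ^+ r * alpha ^+ r / 2 * N ^+ n.+2) <= N * sols c (smooth T1 f) 0.
  apply: le_trans low; apply: (@le_trans _ _ (b ^+ r * N ^+ r * (alpha ^+ r / 2))).
    by rewrite le_eqVlt; apply/orP; left; apply/eqP; rewrite [N ^+ r]exprS; ring.
  by apply: ler_wpM2r => //; apply: divr_ge0 => //; apply: exprn_ge0; apply: ltW.
rewrite ler_pM2l // in low2.
have := le_trans low2 up.
have -> : r%:R * (eps * N ^+ n.+2) = b ^+ r * alpha ^+ r / 4 * N ^+ n.+2.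
  by rewrite /eps; move: (b ^+ r) (alpha ^+ r) (N ^+ _) (r%:R : R) r_gt0 => u v w k k_gt0; field; rewrite gt_eqF.
move: (b ^+ r * alpha ^+ r) (N ^+ _) (sols _ _ _) => u v w; lra.
Qed.

End Roth.

(** Start from the whole field with [m] above [1 / kappa]; the energy then only has to exceed a
    negative number. *)
Lemma sols_large (R : realType) (alpha : R) n : 0 < alpha ->
  exists2 d : R, 0 < d & forall (F : finFieldType) (A : {set F}) (c : 'I_n.+3 -> F),
    (forall i, c i != 0) -> \sum_i c i = 0 -> alpha * #|F|%:R <= #|A|%:R ->
    d * #|F|%:R ^+ n.+2 <= sols c (ind R A) 0.
Proof.
move=> alpha_gt0; set kappa : R := (alpha ^+ n.+3 / (4 * n.+3%:R)) ^+ 2 / 3.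
have kappa_pos : 0 < kappa := kappa_gt0 n alpha_gt0.
pose m := (Num.bound kappa^-1).
have [d d_gt0 large] := sols_large_energy n alpha_gt0 m ltr01.
exists d => // F A c c0 c_sum0 A_dense; apply: (large F A [set: F]) => //.
  by rewrite mul1r cardsT.
apply: lt_le_trans (_ : 0 <= _); last by apply: sumr_ge0 => x _; apply: sqr_ge0.
rewrite pmulr_llt0 ?card_F_gt0 // subr_lt0 -/kappa -ltr_pdivrMr // mul1r.
by apply: archi_boundP; rewrite invr_ge0 ltW.
Qed.

(** * Bounded chromatic number *)

(** Parities alternate around the cycle, and the last vertex gets the third colour. *)
Definition cycle_color Q (u : 'I_Q.+2) : 'I_3 :=
  if u == -1 then inord 2 else inord (odd u).

Lemma cycle_color_succ Q (u : 'I_Q.+2) : cycle_color (u + 1) != cycle_color u.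
Proof.
rewrite /cycle_color; have [-> | u1] := eqVneq u (-1).
  rewrite addNr [0 == _]eq_sym oppr_eq0 oner_eq0; apply/eqP => /(congr1 (@nat_of_ord 3)).
  by rewrite !inordK.
have u1E := val_Zp_succ u; rewrite (negPf u1) in u1E.
have odd_lt (b : bool) : (b < 3)%N by case: b.
case: (u + 1 == -1); apply/eqP => /(congr1 (@nat_of_ord 3)); rewrite !inordK ?odd_lt // ?u1E /=.
  by case: (odd u).
by case: (odd u).
Qed.

Lemma cycle_coloring p (a : 'F_p) : a != 0 ->
  exists g : 'F_p -> 'I_3, forall u v, v - u = a -> g u != g v.
Proof.
move=> a0; exists (fun u => cycle_color (u / a)) => u v /eqP; rewrite subr_eq => /eqP->.
by rewrite addrC mulrDl divff // eq_sym cycle_color_succ.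
Qed.

Lemma card_determined (F : finFieldType) n (S : {set {ffun 'I_n.+2 -> F}}) (i j : 'I_n.+2) :
  i != j -> (forall z z', z \in S -> z' \in S ->
    (forall l, l != i -> l != j -> z l = z' l) -> z = z') -> (#|S| <= #|F| ^ n)%N.
Proof.
move=> ij determined.
pose D : {set 'I_n.+2} := ~: [set i; j].
pose proj (z : {ffun 'I_n.+2 -> F}) := [ffun l => if l \in D then z l else 0].
have cardD : #|D| = n.
  by have := cardsC [set i; j]; rewrite -/D cards2 ij card_ord => -[].
rewrite -[n in (_ ^ n)%N]cardD -(card_pffun_on (0 : F) (mem D) (mem F)).
rewrite -(@card_in_imset _ _ proj); last first.
  move=> z z' zS z'S /ffunP e; apply: determined => // l li lj.
  by have := e l; rewrite !ffunE !inE negb_or li lj.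
apply/subset_leq_card/subsetP => _ /imsetP[z _ ->].
apply/pffun_onP; split; last by move=> ? _.
by apply/subsetP => l; rewrite inE ffunE; case: ifP => //; rewrite eqxx.
Qed.

Lemma lin_determined (F : finFieldType) n (c : 'I_n -> F) (m : 'I_n) (z z' : {ffun 'I_n -> F}) :
  c m != 0 -> \sum_i c i * z i = \sum_i c i * z' i -> (forall l, l != m -> z l = z' l) -> z = z'.
Proof.
move=> cm; rewrite (bigD1 m) //= [RHS](bigD1 m) //= => e zz'.
have e' : \sum_(i | i != m) c i * z i = \sum_(i | i != m) c i * z' i.
  by apply: eq_bigr => l lm; rewrite zz'.
apply/ffunP => l; have [->|/zz' //] := eqVneq l m.
by move: e; rewrite e' => /addIr/(mulfI cm).
Qed.

Section Bounded.
Variables (R : realType) (k n : nat) (c : 'I_k -> int) (e : 'I_n.+3 -> 'I_k).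
Hypotheses (e_inj : injective e) (e_sum : \sum_i c (e i) = 0).

Section Prime.
Variables (p : nat) (A : {set 'F_p}).
Hypothesis p_prime : prime p.
Hypothesis c_neq0 : forall l, (c l)%:~R != 0 :> 'F_p.
Hypothesis A_free : solution_free c A.
Local Notation F := 'F_p.
Let cF (i : 'I_n.+3) : F := (c (e i))%:~R.
Let E : {set 'I_k} := [set e i | i in 'I_n.+3].

(** A solution with distinct entries avoiding [x0] would extend by [x0] to a forbidden one. So two
    entries agree or one is a value of [x0], and either leaves [n + 1] free coordinates. *)
Lemma solutions_few (x0 : 'I_k -> F) : injective x0 -> (forall l, x0 l \in A) ->
  (#|[set z : {ffun 'I_n.+3 -> F} | (\sum_i cF i * z i == - \sum_(l | l \notin E) (c l)%:~R * x0 l)%R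
     && [forall i, z i \in A]]| <= (n.+3 * n.+3 + n.+3 * k) * p ^ n.+1)%N.
Proof.
move=> x0_inj x0A; set t := - _; set S := [set z | _].
have cF0 i : cF i != 0 by apply: c_neq0.
pose S1 (ij : 'I_n.+3 * 'I_n.+3) := [set z : {ffun 'I_n.+3 -> F} |
  [&& ij.1 != ij.2, \sum_i cF i * z i == t & z ij.1 == z ij.2]].
pose S2 (il : 'I_n.+3 * 'I_k) := [set z : {ffun 'I_n.+3 -> F} |
  (\sum_i cF i * z i == t) && (z il.1 == x0 il.2)].
have third (i j : 'I_n.+3) : exists m, (m != i) && (m != j).
  apply/existsP; have : (2 < #|{: 'I_n.+3}|)%N by rewrite card_ord.
  apply: contraLR; rewrite negb_exists -leqNgt => /forallP h.
  apply: leq_trans (_ : #|[set i; j]| <= _)%N; last by rewrite cards2; case: (i != j).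
  by apply/subset_leq_card/subsetP => m _; have := h m; rewrite !inE negb_and !negbK.
have card1 ij : (#|S1 ij| <= p ^ n.+1)%N.
  case: ij => i j; have [-> | ij] := eqVneq i j.
    by rewrite (_ : S1 _ = set0) ?cards0 //; apply/setP => z; rewrite !inE /= eqxx.
  have [m /andP[mi mj]] := third i j.
  rewrite -[X in (X ^ _)%N](card_Fp p_prime); apply: (@card_determined _ n.+1 _ j m); first by rewrite eq_sym.
  move=> z z'; rewrite !inE /= => /and3P[_ /eqP s1 /eqP zij] /and3P[_ /eqP s2 /eqP z'ij] agree.
  apply: (lin_determined (cF0 m)); first by rewrite s1 s2.
  move=> l lm; have [->|lj] := eqVneq l j; last exact: agree.
  by rewrite -zij -z'ij agree // eq_sym.
have card2 il : (#|S2 il| <= p ^ n.+1)%N.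
  case: il => i l; have [m /andP[mi _]] := third i i.
  rewrite -[X in (X ^ _)%N](card_Fp p_prime); apply: (@card_determined _ n.+1 _ i m); first by rewrite eq_sym.
  move=> z z'; rewrite !inE /= => /andP[/eqP s1 /eqP zi] /andP[/eqP s2 /eqP z'i] agree.
  apply: (lin_determined (cF0 m)); first by rewrite s1 s2.
  by move=> j jm; have [->|ji] := eqVneq j i; [rewrite zi z'i | apply: agree].
pose SS (s : ('I_n.+3 * 'I_n.+3) + ('I_n.+3 * 'I_k)) := match s with inl ij => S1 ij | inr il => S2 il end.
have cover z : z \in S -> exists s, z \in SS s.
  rewrite inE => /andP[z_sum /forallP zA].
  case: (pickP (fun ij : 'I_n.+3 * 'I_n.+3 => (ij.1 != ij.2) && (z ij.1 == z ij.2))) => [ij /andP[h1 h2]|z_inj].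
    by exists (inl ij); rewrite /SS inE; apply/and3P; split.
  case: (pickP (fun il : 'I_n.+3 * 'I_k => z il.1 == x0 il.2)) => [il h|z_x0].
    by exists (inr il); rewrite /SS inE; apply/andP; split.
  exfalso; apply: A_free.
  pose x l := if [pick i | e i == l] is Some i then z i else x0 l.
  have xe i : x (e i) = z i.
    rewrite /x; case: pickP => [j /eqP/e_inj-> // | /(_ i)]; by rewrite eqxx.
  have xE l : l \notin E -> x l = x0 l.
    rewrite /x; case: pickP => // i /eqP <-; by rewrite imset_f.
  exists x; split.
  - move=> l1 l2; rewrite /x; case: pickP => [i /eqP<- | n1]; case: pickP => [j /eqP<- | n2] zz.
    + congr e; apply/eqP; have := z_inj (i, j); rewrite /= zz eqxx andbT.
      by move/negbT; rewrite negbK.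
    + by have := z_x0 (i, l2); rewrite /= zz eqxx.
    + by have := z_x0 (j, l1); rewrite /= -zz eqxx.
    exact: x0_inj.
  - by move=> l; rewrite /x; case: pickP => [i _|_]; [apply: zA | apply: x0A].
  rewrite (bigID (mem E)) /= big_imset /=; last by move=> ? ? _ _; apply: e_inj.
  under eq_bigr => i _ do rewrite xe.
  under [X in _ + X]eq_bigr => l lE do rewrite xE //.
  by rewrite (eqP z_sum) /t addNr.
apply: leq_trans (card_le_cover cover) _.
rewrite big_sumType /= mulnDl; apply: leq_add.
  apply: (@leq_trans (\sum_(ij : 'I_n.+3 * 'I_n.+3) p ^ n.+1)); first by apply: leq_sum => ij _.
  by rewrite sum_nat_const card_prod !card_ord.
apply: (@leq_trans (\sum_(il : 'I_n.+3 * 'I_k) p ^ n.+1)); first by apply: leq_sum => il _.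
by rewrite sum_nat_const card_prod !card_ord.
Qed.

Lemma sols_ind (c' : 'I_n.+3 -> F) t : sols c' (ind R A) t =
  #|[set z : {ffun 'I_n.+3 -> F} | (\sum_i c' i * z i == t)%R && [forall i, z i \in A]]|%:R.
Proof.
rewrite -sum1_card natr_sum /sols [LHS]big_mkcond [RHS]big_mkcond; apply: eq_bigr => z _.
rewrite inE; case: (_ == t) => //=; case: forallP => [zA | nA].
  by rewrite big1 // => i _; rewrite /ind zA.
have /existsP[i iA] : [exists i, z i \notin A].
  by rewrite -negb_forall; apply/forallP.
by rewrite (bigD1 i) //= /ind (negPf iA) mul0r.
Qed.

Definition period (eps : R) (x : F) : bool := [forall l : 'I_k, forall y,
  `|sols cF (ind R A) (y + (c l)%:~R * x) - sols cF (ind R A) y| <= eps].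

(** With [k] periods in [A] at the indices outside the image of [e], more solutions would remain
    than [solutions_few] allows. *)
Lemma periods_few (d eps : R) : d * p%:R ^+ n.+2 <= sols cF (ind R A) 0 ->
  k%:R * eps <= d / 2 * p%:R ^+ n.+2 -> (n.+3 * n.+3 + n.+3 * k)%:R < d / 2 * p%:R -> 0 <= eps ->
  (#|[set x in A | period eps x]| < k)%N.
Proof.
move=> large eps_le p_large eps_ge0; rewrite ltnNge; apply/negP; set X := [set x in A | _] => kX.
pose x0 (l : 'I_k) := enum_val (widen_ord kX l).
have x0X l : x0 l \in X := enum_valP _.
have x0_inj : injective x0 by move=> l l' /enum_val_inj/(congr1 val) /= /val_inj.
have x0A l : x0 l \in A by have := x0X l; rewrite inE => /andP[].
have := solutions_few x0_inj x0A; set t := - _; set S := [set z | _] => S_le.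
pose s := enum (~: E).
have tE : t = \sum_(l <- s) - ((c l)%:~R * x0 l).
  by rewrite /t sumrN /s big_enum; congr (- _); apply: eq_bigl => l; rewrite inE.
have low : d / 2 * p%:R ^+ n.+2 <= sols cF (ind R A) t.
  have step l y : - sols cF (ind R A) (y + - ((c l)%:~R * x0 l)) <= - sols cF (ind R A) y + eps.
    have := x0X l; rewrite inE => /andP[_ /forallP/(_ l)/forallP/(_ (y - (c l)%:~R * x0 l))].
    rewrite subrK => /ler_normlP[_]; set u := sols _ _ _; set v := sols _ _ _; lra.
  (* The point [t] is reached from 0 in at most [k] steps. The signs are reversed because [walk_le]
     bounds increases. *)
  have := @walk_le R F k (fun y => - sols cF (ind R A) y) eps s _ 0 step.
  rewrite add0r -tE => walk.
  have : (size s)%:R * eps <= d / 2 * p%:R ^+ n.+2.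
    apply: le_trans eps_le; rewrite ler_wpM2r // ler_nat /s -cardE.
    by apply: leq_trans (max_card _) _; rewrite card_ord.
  have -> : d / 2 * p%:R ^+ n.+2 = d * p%:R ^+ n.+2 / 2 by field.
  move: walk large; move: (sols _ _ t) (sols _ _ 0) (_ * eps) (d * _) => u v w x; lra.
have := le_trans low (_ : _ <= (n.+3 * n.+3 + n.+3 * k)%:R * p%:R ^+ n.+1).
rewrite sols_ind -/S => /(_ _); rewrite -natrX -natrM ler_nat => /(_ S_le).
rewrite natrM natrX exprS mulrA ler_pM2r; last by rewrite exprn_gt0 // ltr0n prime_gt0.
by rewrite leNgt p_large.
Qed.

End Prime.

Lemma bounded_chromatic (d : R) : 0 < d -> (forall l, c l != 0) ->
  exists C : nat, forall p, prime p -> forall A : {set 'F_p}, solution_free c A ->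
    d * p%:R <= #|A|%:R -> cayley_colorable A C.
Proof.
move=> d_gt0 c_neq0.
have k_gt0 : (0 < k)%N := leq_ltn_trans (leq0n _) (ltn_ord (e ord0)).
have k_gt0R : 0 < k%:R :> R by rewrite ltr0n.
have [d0 d0_gt0 large] := sols_large n d_gt0.
(* An error [2 eps p ^ (n + 2)] in each of [k] steps uses up half of the count [d0 p ^ (n + 2)]. *)
pose eps := d0 / (4 * k%:R).
have eps_gt0 : 0 < eps by apply: divr_gt0 => //; apply: mulr_gt0; rewrite ?ltr0n.
have [d1 d1_gt0 periodic] := sols_almost_periodic eps_gt0 d_gt0.
pose C1 := Num.bound d1^-1.
have C1_large : 1 <= C1%:R * d1.
  rewrite -ler_pdivrMr // mul1r ltW //; apply: archi_boundP; rewrite invr_ge0 ltW //.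
pose Kb := Num.bound ((n.+3 * n.+3 + n.+3 * k)%:R / (d0 / 2)).
(* Primes up to [p0] get one colour per vertex; beyond it no coefficient vanishes modulo [p], and
   [periods_few] applies. *)
pose p0 := (\sum_l `|c l| + Kb)%N.
pose J (C : nat) := ({ffun 'I_k -> 'I_C} * {ffun 'I_k -> 'I_3})%type.
exists (maxn p0 #|{: J C1}|) => p p_prime A A_free A_dense.
have [p_small|p_large] := leqP p p0.
  have p_le : (#|{: 'F_p}| <= maxn p0 #|{: J C1}|)%N by rewrite card_Fp // leq_max p_small.
  exists (fun u => widen_ord p_le (enum_rank u)) => u v uv _.
  by apply: contra uv => /eqP/(congr1 val) /= /val_inj/enum_rank_inj->.
have c_neq0p l : (c l)%:~R != 0 :> 'F_p.
  rewrite -(dvdz_pcharf (pchar_Fp p_prime)) dvdzE absz_nat; apply/negP => /dvdn_leq.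
  rewrite absz_gt0 => /(_ (c_neq0 l)); apply/negP; rewrite -ltnNge; apply: leq_ltn_trans p_large.
  by rewrite /p0 (bigD1 l) //= -addnA leq_addr.
have cardF : #|{: 'F_p}| = p by rewrite card_Fp.
pose cF (i : 'I_n.+3) : 'F_p := (c (e i))%:~R.
have cF_sum : \sum_i cF i = 0 by rewrite /cF -rmorph_sum e_sum.
have A_dense' : d * #|{: 'F_p}|%:R <= #|A|%:R by rewrite cardF.
have h_large := large 'F_p A cF (fun i => c_neq0p _) cF_sum A_dense'; rewrite cardF in h_large.
pose e2 := 2 * (eps * p%:R ^+ n.+2).
have p_gt0 : 0 < p%:R :> R by rewrite ltr0n prime_gt0.
have e2_ge0 : 0 <= e2 by apply: mulr_ge0 => //; apply: mulr_ge0; [exact: ltW | apply: exprn_ge0; exact: ltW].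
pose X := [set x in A | period A e2 x].
have X_few : (#|X| < k)%N.
  apply: (periods_few p_prime c_neq0p A_free h_large) => //.
    rewrite /e2 /eps le_eqVlt; apply/orP; left; apply/eqP.
    by move: (p%:R ^+ _) (k%:R : R) k_gt0R => u w w_gt0; field; rewrite gt_eqF.
  rewrite mulrC -ltr_pdivrMr ?divr_gt0 //; apply: (@lt_le_trans _ _ Kb%:R).
    by apply: archi_boundP; rewrite divr_ge0 ?ler0n // divr_ge0 // ltW.
  by rewrite ler_nat; apply: leq_trans (ltnW p_large); rewrite leq_addl.
have [T [T_dense T_per]] := periodic 'F_p A n cF (fun i => c_neq0p _) A_dense'.
(* Equal colours make [u - v] a difference of two differences from [Tl], which doubles the error. *)
have /fin_all_exists[f f_per] (l : 'I_k) : exists f : 'F_p -> 'I_C1, forall u v, f u = f v ->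
    forall y, `|sols cF (ind R A) (y + (c l)%:~R * (u - v)) - sols cF (ind R A) y| <= e2.
  pose Tl := (fun x => (c l)%:~R * x) @^-1: T.
  have cardTl : #|Tl| = #|T| by rewrite card_preimset //; apply: mulfI.
  have Tl_dense : d1 * #|{: 'F_p}|%:R <= #|Tl|%:R by rewrite cardTl.
  have [f f_diff] := dense_coloring d1_gt0 Tl_dense C1_large.
  exists f => u v /f_diff[t1 [t2 [t3 [t4 [[]]]]]]; rewrite !inE => h1 h2 h3 h4 -> y.
  rewrite !mulrBr.
  set s1 := (c l)%:~R * t1 in h1 *; set s2 := (c l)%:~R * t2 in h2 *.
  set s3 := (c l)%:~R * t3 in h3 *; set s4 := (c l)%:~R * t4 in h4 *.
  have /forallP/(_ (y + (s1 - s2 - (s3 - s4)))) g1 := T_per _ _ h3 h4.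
  have /forallP/(_ y) g2 := T_per _ _ h1 h2.
  rewrite -addrA subrK distrC in g1; rewrite cardF in g1 g2.
  by apply: le_trans (ler_distD _ _ _) _; apply: le_trans (lerD g1 g2) _; rewrite /e2 mulr_natl mulr2n.
(* Indices beyond the size of [X] get 0, for which a constant colouring suffices. *)
pose a j := nth 0 (enum X) j.
have /fin_all_exists[g g_col] (j : 'I_k) : exists g : 'F_p -> 'I_3, a j != 0 ->
    forall u v, v - u = a j -> g u != g v.
  have [aj|/cycle_coloring[g g_col]] := eqVneq (a j) 0; last by exists g.
  by exists (fun=> ord0); rewrite aj eqxx.
pose color u : J C1 := ([ffun l => f l u], [ffun j => g j u]).
have J_le : (#|{: J C1}| <= maxn p0 #|{: J C1}|)%N by rewrite leq_maxr.
exists (fun u => widen_ord J_le (enum_rank (color u))) => u v uv vuA.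
apply/eqP => /(congr1 val) /= /val_inj/enum_rank_inj [/ffunP fE /ffunP gE].
(* The colours [f] put [v - u] into [X], and the 3-colouring of its cycle then separates [u] from
   [v]. *)
have vuX : v - u \in X.
  rewrite inE vuA; apply/forallP => l; apply/forallP => y; apply: f_per.
  by have := fE l; rewrite !ffunE.
have idx_lt : (index (v - u)%R (enum X) < k)%N.
  by apply: ltn_trans X_few; rewrite cardE index_mem mem_enum.
pose j := Ordinal idx_lt.
have aj : v - u = a j by rewrite /a nth_index ?mem_enum.
have := g_col j _ u v aj; rewrite -aj subr_eq0 eq_sym => /(_ uv).
by have := gE j; rewrite !ffunE => ->; rewrite eqxx.
Qed.

End Bounded.

(* The chromatic threshold *)
From mathcomp Require Import classical_sets.

(** No set has density 2, so 2 qualifies vacuously and the infimum is a genuine one. *)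
Lemma good_densities_nonempty (R : realType) (k : nat) (c : 'I_k -> int) :
  (@good_densities R k c !=set0)%classic.
Proof.
exists 2; split; first by rewrite ltr0n.
exists 0%N => p p_prime A _; rewrite -natrM ler_nat => A_large; exfalso.
have := leq_trans A_large (max_card _); rewrite card_Fp // leqNgt.
by rewrite -[X in (X < _)%N]mul1n ltn_pmul2r ?prime_gt0.
Qed.

Lemma has_lbound_good_densities (R : realType) (k : nat) (c : 'I_k -> int) :
  has_lbound (@good_densities R k c).
Proof. by exists 0 => d [/ltW]. Qed.

Theorem theorem1p3 (R : realType) (k : nat) (c : 'I_k -> int)
  (hk : (3 <= k)%N) (hc : forall i, c i != 0) :
  @delta_chi R k c = 0 <->
  exists I : {set 'I_k}, (3 <= #|I|)%N /\ \sum_(i in I) c i = 0.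
Proof.
split=> [delta0 | [I [I_ge3 I_sum]]].
  case: (pickP (fun I : {set 'I_k} => (3 <= #|I|)%N && (\sum_(i in I) c i == 0))) => [I /andP[I_ge3 /eqP]|no_zero_sum].
    by exists I.
  have [|M M_gt0 hard] := high_chromatic_dense hk hc.
    by move=> I I_ge3; have := no_zero_sum I; rewrite I_ge3 /= => ->.
  (* No density below [1 / M] is good, since [hard] gives a counterexample for every number of
     colours. *)
  suff : M%:R^-1 <= @delta_chi R k c by rewrite delta0 leNgt invr_gt0 ltr0n M_gt0.
  apply: lb_le_inf; first exact: good_densities_nonempty.
  move=> d [_ [C colorable]]; rewrite leNgt; apply/negP => d_lt.
  have [p p_prime [A [A_free A_dense not_colorable]]] := hard C.
  apply: not_colorable; apply: colorable A_free _ => //.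
  apply: (@le_trans _ _ (M%:R^-1 * p%:R)); first by rewrite ler_wpM2r // ltW.
  by rewrite ler_pdivrMl ?ltr0n // -natrM ler_nat.
apply/eqP; rewrite eq_le; apply/andP; split; last first.
  by apply: lb_le_inf; [exact: good_densities_nonempty | move=> d [/ltW]].
rewrite leNgt; apply/negP => delta_gt0.
have d_gt0 : 0 < @delta_chi R k c / 2 by rewrite divr_gt0.
have [n En] : exists n, #|I| = n.+3 by exists (#|I| - 3)%N; rewrite -addn3 subnK.
pose e (i : 'I_n.+3) := enum_val (cast_ord (esym En) i).
have e_inj : injective e by move=> i j /enum_val_inj/cast_ord_inj.
have e_sum : \sum_i c (e i) = 0.
  rewrite -[RHS]I_sum [RHS]big_enum_val /=.
  rewrite [RHS](reindex (cast_ord (esym En))) //.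
  by exists (cast_ord En) => i _; rewrite ?cast_ordK ?cast_ordKV.
have [C colorable] := bounded_chromatic e_inj e_sum d_gt0 hc.
(* Half of a positive threshold would be a good density below the infimum. *)
have : @delta_chi R k c <= @delta_chi R k c / 2.
  by apply: ge_inf; [exact: has_lbound_good_densities | split=> //; exists C].
by rewrite ler_pdivlMr // mulr_natr mulr2n gerDl leNgt delta_gt0.
Qed.
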